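(* Let $q>0$ and let $\mathcal{A}=\mathbb{C}\langle x,x^*\mid xx^*=qx^*x\rangle$. A linear functional $F$ on $\mathcal{A}$ is a $q$-moment functional if and only if $F$ is strongly positive.
   Context: $\mathcal{A}$ is the unital complex $*$-algebra with single generator $x$ and defining relation $xx^*=qx^*x$; the set $\{x^{*m}x^n: m,n\in\mathbb{N}_0\}$ is a vector space basis of $\mathcal{A}$. A densely defined operator $X$ on a Hilbert space is called $q$-normal if $\mathcal{D}(X)=\mathcal{D}(X^* )$ and $\|X^*f\|=\sqrt q\,\|Xf\|$ for all $f\in\mathcal{D}(X)$. Put $\mathcal{D}^\infty(X)=\bigcap_{n\ge1}\mathcal{D}(X^n)$. For $f=\sum_{m,n}\alpha_{mn}x^{*m}x^n\in\mathcal{A}$ write $f(X,X^* )=\sum_{m,n}\alpha_{mn}X^{*m}X^n$. An element $f=f^*\in\mathcal{A}$ belongs to $\mathcal{A}_+$ if $\langle f(X,X^* )\varphi,\varphi\rangle\ge0$ for every $q$-normal operator $X$ and every $\varphi\in\mathcal{D}^\infty(X)$. A $*$-representation $\pi$ of $\mathcal{A}$ on a dense linear subspace $\mathcal{D}(\pi)$ of a Hilbert space is an algebra homomorphism of $\mathcal{A}$ into the linear operators on $\mathcal{D}(\pi)$ with $\pi(1)=I$ and $\langle\pi(a)\varphi,\psi\rangle=\langle\varphi,\pi(a^* )\psi\rangle$ for $\varphi,\psi\in\mathcal{D}(\pi)$, $a\in\mathcal{A}$. It is well-behaved if there is a $q$-normal operator $X$ with $\mathcal{D}(\pi)=\mathcal{D}^\infty(X)$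 and $\pi(x)=X\upharpoonright\mathcal{D}^\infty(X)$. A linear functional $F$ on $\mathcal{A}$ is a $q$-moment functional if there exist a well-behaved $*$-representation $\pi$ of $\mathcal{A}$ and a vector $\xi\in\mathcal{D}(\pi)$ with $F(a)=\langle\pi(a)\xi,\xi\rangle$ for all $a\in\mathcal{A}$. It is strongly positive if $F(a)\ge0$ for all $a\in\mathcal{A}_+$. *)

(* Defs.v *)
From HB Require Import structures.
From mathcomp Require Import all_boot all_order all_algebra.
From mathcomp Require Import sesquilinear.
From mathcomp Require Import boolp classical_sets reals.
From mathcomp Require Import topology normedtype.
From mathcomp Require Import complex.

Set Implicit Arguments.
Unset Strict Implicit.
Unset Printing Implicit Defensive.

Import Order.TTheory GRing.Theory Num.Theory.
Import numFieldNormedType.Exports.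

Local Open Scope classical_set_scope.
Local Open Scope ring_scope.

(** * Complex Hilbert spaces *)

(* Inner products are linear in the first argument and conjugate-linear in
   the second one. *)
HB.mixin Record CompleteNormedModule_isHilbert (R : realType) H
    of CompleteNormedModule R[i] H := {
  inner : {dot H for (Num.conj : R[i] -> R[i])} ;
  sqr_norm_inner : forall f : H, `|f| ^+ 2 = inner f f
}.

#[short(type="hilbertType")]
HB.structure Definition Hilbert (R : realType) :=
  { H of CompleteNormedModule_isHilbert R H & CompleteNormedModule R[i] H }.

(** * The algebra C<x, x^* | x x^* = q x^* x> *)

(* Modelled on its basis of normally ordered monomials: [a : qplane q] stands
   for the sum of the a`_n`_m x^*m x^n, so the inner variable is x^* and the
   outer one is x. The product is not that of {poly {poly R[i]}}: it is twisted
   by x^n x^*k = q^(nk) x^*k x^n. By [qx_comm] and [qplane_presentation] this is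
   the algebra presented by x x^* = q x^* x, and [qstar] is its involution. *)
Definition qplane (R : realType) (q : R) : Type := {poly {poly R[i]}}.

HB.instance Definition _ (R : realType) (q : R) :=
  GRing.Zmodule.copy (qplane q) {poly {poly R[i]}}.

Section QPlane.
Variables (R : realType) (q : R).
Local Notation C := R[i].
Local Notation A := (qplane q).

Definition qcoef (a : A) (m n : nat) : C :=
  ((a : {poly {poly C}})`_n : {poly C})`_m.

Definition qmono (m n : nat) : A := ('X^m : {poly C}) *: 'X^n.

Definition qscale (c : C) (a : A) : A := c%:P *: (a : {poly {poly C}}).

Lemma qcoefP (a b : A) : (forall m n, qcoef a m n = qcoef b m n) -> a = b.
Proof. by move=> ab; apply/polyP => n; apply/polyP => m; exact: ab. Qed.

Lemma qcoefD (a b : A) m n : qcoef (a + b) m n = qcoef a m n + qcoef b m n.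
Proof.
rewrite /qcoef.
by rewrite (coefD (a : {poly {poly C}}) (b : {poly {poly C}})) coefD.
Qed.

Lemma qcoef_scale c (a : A) m n : qcoef (qscale c a) m n = c * qcoef a m n.
Proof. by rewrite /qcoef /qscale coefZ coefCM. Qed.

Lemma qcoef_mono m n i j :
  qcoef (qmono m n) i j = ((i == m) && (j == n))%:R.
Proof.
rewrite /qcoef /qmono coefZ coefXn.
by case: (j == n); rewrite ?andbF ?mulr0 ?coef0// mulr1 coefXn andbT.
Qed.

Lemma qscaleA c d a : qscale c (qscale d a) = qscale (c * d) a.
Proof. by apply/qcoefP => m n; rewrite !qcoef_scale mulrA. Qed.

Lemma qscale1 : left_id 1 qscale.
Proof. by move=> a; apply/qcoefP => m n; rewrite !qcoef_scale mul1r. Qed.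

Lemma qscaleDr : right_distributive qscale +%R.
Proof.
by move=> c a b; apply/qcoefP => m n; rewrite !(qcoefD,qcoef_scale) mulrDr.
Qed.

Lemma qscaleDl a : {morph qscale^~ a : c d / c + d}.
Proof.
by move=> c d; apply/qcoefP => m n; rewrite !(qcoefD,qcoef_scale) mulrDl.
Qed.

HB.instance Definition _ := GRing.Zmodule_isLmodule.Build C A
  qscaleA qscale1 qscaleDr qscaleDl.

Lemma qcoefZ c (a : A) m n : qcoef (c *: a) m n = c * qcoef a m n.
Proof. exact: qcoef_scale. Qed.

(* The linear map sending x^*m x^n to g m n. *)
Definition qlin (V : lmodType C) (g : nat -> nat -> V) (a : A) : V :=
  \sum_(n < size (a : {poly {poly C}}))
    \sum_(m < size ((a : {poly {poly C}})`_n)) qcoef a m n *: g m n.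

Definition qmul (a b : A) : A :=
  qlin (fun m n =>
    qlin (fun k l => (q ^+ (n * k))%:C%C *: qmono (m + k) (n + l)) b) a.

Definition qstar (a : A) : A :=
  swapXY (map_poly (map_poly (Num.conj : C -> C)) a).

Definition qx : A := qmono 0 1.

Lemma qcoef_star a m n : qcoef (qstar a) m n = (qcoef a n m)^*.
Proof.
by rewrite /qcoef /qstar coef_swapXY !coef_map.
Qed.

Definition qbound (a : A) (N : nat) : Prop :=
  forall m n, (N <= m)%N || (N <= n)%N -> qcoef a m n = 0.

Lemma qboundW a N M : (N <= M)%N -> qbound a N -> qbound a M.
Proof.
move=> NM aN m n /orP[] Mm; apply: aN.
  by rewrite (leq_trans NM Mm).
by rewrite (leq_trans NM Mm) orbT.
Qed.

Lemma qcoef_out (a : A) m n :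
  (size (a : {poly {poly C}}) <= n)%N -> qcoef a m n = 0.
Proof.
by move=> an; rewrite /qcoef (nth_default (0 : {poly C}) an) coef0.
Qed.

Lemma qbound_ex a : exists N, qbound a N.
Proof.
pose s := size (a : {poly {poly C}}).
pose t := (\max_(n < s) size ((a : {poly {poly C}})`_n)%R)%N.
exists (maxn s t) => m n; rewrite !geq_max => /orP[/andP[sm tm]|/andP[sn tn]].
  rewrite /qcoef; have [ns|sn] := ltnP n s.
    apply: nth_default; apply: leq_trans tm.
    exact: (@leq_bigmax _ (fun n : 'I_s => size (a : {poly {poly C}})`_n)
      (Ordinal ns)).
  by have := qcoef_out m sn; rewrite /qcoef.
exact: qcoef_out.
Qed.

Lemma sum_trunc (V : nmodType) (G : nat -> V) s N :
  (forall i, (s <= i)%N -> G i = 0) -> (forall i, (N <= i)%N -> G i = 0) ->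
  \sum_(i < s) G i = \sum_(i < N) G i.
Proof.
have aux : forall s N, (s <= N)%N -> (forall i, (s <= i)%N -> G i = 0) ->
    \sum_(i < s) G i = \sum_(i < N) G i.
  move=> {s N} s N sN Gs; rewrite (big_ord_widen N G sN) big_mkcond/=.
  by apply: eq_bigr => i _; case: ltnP => // /Gs ->.
move=> Gs GN; have [sN|/ltnW Ns] := leqP s N; first exact: aux.
by apply/esym; exact: aux.
Qed.

Lemma qlinE (V : lmodType C) (g : nat -> nat -> V) a N : qbound a N ->
  qlin g a = \sum_(n < N) \sum_(m < N) qcoef a m n *: g m n.
Proof.
move=> aN; rewrite /qlin.
transitivity (\sum_(n < size (a : {poly {poly C}}))
    \sum_(m < N) qcoef a m n *: g m n).
  apply: eq_bigr => n _.
  apply: (@sum_trunc V (fun m => qcoef a m n *: g m n)) => m mn.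
    by rewrite /qcoef nth_default// scale0r.
  by rewrite aN ?mn// scale0r.
apply: (@sum_trunc V (fun n => \sum_(m < N) qcoef a m n *: g m n)) => n sn.
  by apply: big1 => m _; rewrite qcoef_out// scale0r.
by apply: big1 => m _; rewrite aN ?sn ?orbT// scale0r.
Qed.

Lemma qlin_is_linear (V : lmodType C) (g : nat -> nat -> V) : linear (qlin g).
Proof.
move=> c a b.
have [N1 a1] := qbound_ex a; have [N2 b1] := qbound_ex b.
have [N3 c1] := qbound_ex (c *: a + b).
pose N := maxn N1 (maxn N2 N3).
rewrite (@qlinE _ _ _ N (qboundW _ c1)) ?leq_max ?leqnn ?orbT//.
rewrite (@qlinE _ _ _ N (qboundW _ a1)) ?leq_max ?leqnn ?orbT//.
rewrite (@qlinE _ _ _ N (qboundW _ b1)) ?leq_max ?leqnn ?orbT//.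
rewrite scaler_sumr -big_split; apply: eq_bigr => n _ /=.
rewrite scaler_sumr -big_split; apply: eq_bigr => m _ /=.
by rewrite qcoefD qcoefZ scalerDl scalerA.
Qed.

HB.instance Definition _ (V : lmodType C) (g : nat -> nat -> V) :=
  GRing.isLinear.Build C A V *:%R (qlin g) (qlin_is_linear g).

Lemma qlin_mono (V : lmodType C) (g : nat -> nat -> V) m n :
  qlin g (qmono m n) = g m n.
Proof.
have bd : qbound (qmono m n) (maxn m n).+1.
  move=> i j ij; rewrite qcoef_mono.
  case: eqP => [im|//]; case: eqP => [jn|//]; move: ij.
  by rewrite im jn !gtn_max !ltnn andbF.
rewrite (qlinE _ bd).
have nN : (n < (maxn m n).+1)%N by rewrite ltnS leq_maxr.
have mN : (m < (maxn m n).+1)%N by rewrite ltnS leq_maxl.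
rewrite (bigD1 (Ordinal nN))//= [X in _ + X]big1 ?addr0; last first.
  move=> j /eqP jn; apply: big1 => i _; rewrite qcoef_mono.
  case: (eqVneq (j : nat) n) => [jn'|]; last by rewrite andbF scale0r.
  by exfalso; apply: jn; exact/val_inj.
rewrite (bigD1 (Ordinal mN))//= [X in _ + X]big1 ?addr0; last first.
  move=> i /eqP im; rewrite qcoef_mono.
  case: (eqVneq (i : nat) m) => [im'|]; last by rewrite scale0r.
  by exfalso; apply: im; exact/val_inj.
by rewrite qcoef_mono !eqxx scale1r.
Qed.

Lemma qlin_id a : qlin qmono a = a.
Proof.
have [N aN] := qbound_ex a; rewrite (qlinE _ aN).
apply/qcoefP => m n.
have qsum (I : finType) (F : I -> A) :
    qcoef (\sum_i F i) m n = \sum_i qcoef (F i) m n.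
  apply: (big_morph (fun a => qcoef a m n)) => [b c|]; first exact: qcoefD.
  by rewrite /qcoef !coef0.
rewrite qsum; under eq_bigr do rewrite qsum.
under eq_bigr do under eq_bigr do rewrite qcoefZ qcoef_mono.
have [mN|Nm] := ltnP m N; last first.
  rewrite aN ?Nm//; apply: big1 => j _; apply: big1 => i _.
  by rewrite (gtn_eqF (leq_trans (ltn_ord i) Nm)) mulr0.
have [nN|Nn] := ltnP n N; last first.
  rewrite aN ?Nn ?orbT//; apply: big1 => j _; apply: big1 => i _.
  by rewrite (gtn_eqF (leq_trans (ltn_ord j) Nn)) andbF mulr0.
rewrite (bigD1 (Ordinal nN))//= [X in _ + X]big1 ?addr0; last first.
  move=> j /eqP jn; apply: big1 => i _.
  case: (eqVneq n j) => [jn'|]; last by rewrite andbF mulr0.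
  by exfalso; apply: jn; exact/val_inj.
rewrite (bigD1 (Ordinal mN))//= [X in _ + X]big1 ?addr0; last first.
  move=> i /eqP im.
  case: (eqVneq m i) => [im'|]; last by rewrite mulr0.
  by exfalso; apply: im; exact/val_inj.
by rewrite !eqxx mulr1.
Qed.

Lemma qlin_ext (V : lmodType C) (f g : {linear A -> V}) :
  (forall m n, f (qmono m n) = g (qmono m n)) -> f =1 g.
Proof.
move=> fg a; rewrite -[a]qlin_id; have [N aN] := qbound_ex a.
rewrite (qlinE _ aN) !linear_sum; apply: eq_bigr => n _.
by rewrite !linear_sum; apply: eq_bigr => m _; rewrite !linearZZ fg.
Qed.

Lemma eq_qlin (V : lmodType C) (f g : nat -> nat -> V) :
  (forall m n, f m n = g m n) -> qlin f =1 qlin g.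
Proof. by move=> fg a; apply: qlin_ext => m n; rewrite /= !qlin_mono. Qed.

Lemma qlin_comb (V : lmodType C) c (f g : nat -> nat -> V) a :
  qlin (fun m n => c *: f m n + g m n) a = c *: qlin f a + qlin g a.
Proof.
have [N aN] := qbound_ex a; rewrite !(qlinE _ aN).
rewrite scaler_sumr -big_split; apply: eq_bigr => n _ /=.
rewrite scaler_sumr -big_split; apply: eq_bigr => m _ /=.
by rewrite scalerDr !scalerA mulrC.
Qed.

Lemma qmul_linearr a : linear (qmul a).
Proof.
move=> c b b'; rewrite /qmul -qlin_comb; apply: eq_qlin => m n.
by rewrite linearP.
Qed.

Lemma qmul_mono m n k l :
  qmul (qmono m n) (qmono k l) = (q ^+ (n * k))%:C%C *: qmono (m + k) (n + l).
Proof. by rewrite /qmul !qlin_mono. Qed.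

Lemma qlinear_eq (V : lmodType C) (f g : A -> V) : linear f -> linear g ->
  (forall m n, f (qmono m n) = g (qmono m n)) -> f =1 g.
Proof.
move=> lf lg fg.
pose F : {linear A -> V} := HB.pack f (GRing.isLinear.Build _ _ _ _ f lf).
pose G : {linear A -> V} := HB.pack g (GRing.isLinear.Build _ _ _ _ g lg).
exact: (@qlin_ext V F G).
Qed.

Lemma qmulZl c a b : qmul (c *: a) b = c *: qmul a b.
Proof. by rewrite /qmul linearZZ. Qed.

Lemma qmulDl a a' b : qmul (a + a') b = qmul a b + qmul a' b.
Proof. by rewrite /qmul linearD. Qed.

Lemma qmulDr a b b' : qmul a (b + b') = qmul a b + qmul a b'.
Proof. by have := qmul_linearr a 1 b b'; rewrite !scale1r. Qed.

Lemma qmulZr c a b : qmul a (c *: b) = c *: qmul a b.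
Proof.
have qmul0 : qmul a 0 = 0.
  by apply: (@addrI _ (qmul a 0)); rewrite -qmulDr !addr0.
by have := qmul_linearr a c b 0; rewrite qmul0 !addr0.
Qed.

Lemma qmulA : associative qmul.
Proof.
move=> a b c; move: a; apply: (@qlinear_eq A) => [d a a'|d a a'|m n].
- by rewrite qmulDl qmulZl.
- by rewrite !(qmulDl,qmulZl).
move: b; apply: (@qlinear_eq A) => [d b b'|d b b'|k l].
- by rewrite !(qmulDl,qmulZl,qmulDr,qmulZr).
- by rewrite !(qmulDl,qmulZl,qmulDr,qmulZr).
move: c; apply: (@qlinear_eq A) => [d c c'|d c c'|i j].
- by rewrite !(qmulDl,qmulZl,qmulDr,qmulZr).
- by rewrite !(qmulDl,qmulZl,qmulDr,qmulZr).
rewrite !(qmul_mono,qmulZl,qmulZr) !scalerA -!rmorphM/= -!exprD !addnA.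
by congr ((q ^+ _)%:C%C *: _); rewrite mulnDr mulnDl addnC addnA.
Qed.

Lemma qmul1l : left_id (qmono 0 0) qmul.
Proof.
apply: (@qlinear_eq A) => [c a b|//|k l].
  by rewrite qmulDr qmulZr.
by rewrite qmul_mono mul0n expr0 scale1r !add0n.
Qed.

Lemma qmul1r : right_id (qmono 0 0) qmul.
Proof.
apply: (@qlinear_eq A) => [c a b|//|k l].
  by rewrite qmulDl qmulZl.
by rewrite qmul_mono muln0 expr0 scale1r !addn0.
Qed.

Lemma qmono_neq0 : qmono 0 0 != 0.
Proof.
apply/eqP => /(congr1 (fun a => qcoef a 0 0)).
by rewrite qcoef_mono /qcoef !coef0 => /eqP; rewrite oner_eq0.
Qed.

Lemma qmulDl' : left_distributive qmul +%R.
Proof. by move=> a b c; exact: qmulDl. Qed.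

Lemma qmulDr' : right_distributive qmul +%R.
Proof. by move=> a b c; exact: qmulDr. Qed.

HB.instance Definition _ := GRing.Zmodule_isNzRing.Build A
  qmulA qmul1l qmul1r qmulDl' qmulDr' qmono_neq0.

Lemma qscaleAl c (a b : A) : c *: (a * b) = (c *: a) * b.
Proof. by apply/esym; exact: qmulZl. Qed.

HB.instance Definition _ := GRing.Lmodule_isLalgebra.Build C A qscaleAl.

Lemma qscaleAr c (a b : A) : c *: (a * b) = a * (c *: b).
Proof. by apply/esym; exact: qmulZr. Qed.

HB.instance Definition _ := GRing.Lalgebra_isAlgebra.Build C A qscaleAr.

Lemma qmonoM m n k l : qmono m n * qmono k l =
  (q ^+ (n * k))%:C%C *: qmono (m + k) (n + l).
Proof. exact: qmul_mono. Qed.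

Lemma qstarK : involutive qstar.
Proof. by move=> a; apply/qcoefP => m n; rewrite !qcoef_star conjCK. Qed.

Lemma qstar_comb c (a b : A) : qstar (c *: a + b) = c^* *: qstar a + qstar b.
Proof.
apply/qcoefP => m n.
by rewrite !(qcoef_star,qcoefD,qcoefZ) rmorphD rmorphM.
Qed.

Lemma qstar_mono m n : qstar (qmono m n) = qmono n m.
Proof.
by apply/qcoefP => i j; rewrite qcoef_star !qcoef_mono rmorph_nat andbC.
Qed.

Lemma qstarM (a b : A) : qstar (a * b) = qstar b * qstar a.
Proof.
have qstarZ c (d : A) : qstar (c *: d) = c^* *: qstar d.
  have := qstar_comb c d 0; rewrite !addr0 => ->.
  suff -> : qstar 0 = 0 by rewrite addr0.
  apply/qcoefP => m n; rewrite qcoef_star.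
  by rewrite [in LHS]/qcoef [in RHS]/qcoef !coef0 rmorph0.
rewrite -[RHS]qstarK; congr qstar; move: a.
apply: (@qlinear_eq A) => [c a a'|c a a'|m n].
- by rewrite mulrDl scalerAl.
- by rewrite qstar_comb mulrDr -scalerAr qstar_comb conjCK.
move: b; apply: (@qlinear_eq A) => [c b b'|c b b'|k l].
- by rewrite mulrDr scalerAr.
- by rewrite qstar_comb mulrDl -scalerAl qstar_comb conjCK.
rewrite !qstar_mono !qmonoM qstarZ qstar_mono mulnC.
rewrite (addnC l) (addnC k).
by have -> : (q ^+ (k * n))%:C%C^* = (q ^+ (k * n))%:C%C :> C
  by exact: conjc_real.
Qed.

Lemma qmonoE m n : qmono m n = qstar qx ^+ m * qx ^+ n.
Proof.
have xX k : qx ^+ k = qmono 0 k.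
  elim: k => // k IHk; rewrite exprS IHk /qx qmonoM.
  by rewrite muln0 expr0 scale1r add0n add1n.
have xsX k : qstar qx ^+ k = qmono k 0.
  elim: k => // k IHk; rewrite exprS IHk /qx qstar_mono qmonoM.
  by rewrite mul0n expr0 scale1r addn0 add1n.
by rewrite xX xsX qmonoM mul0n expr0 scale1r addn0 add0n.
Qed.

Lemma qx_comm : qx * qstar qx = q%:C%C *: (qstar qx * qx).
Proof.
rewrite /qx qstar_mono !qmonoM muln0 expr0 scale1r.
by rewrite muln1 expr1 !addn0 !add0n.
Qed.

Lemma qplane_presentation (B : algType C) (y z : B) :
  y * z = q%:C%C *: (z * y) ->
  exists f : {lrmorphism A -> B}, [/\ f qx = y, f (qstar qx) = z &
    forall g : {lrmorphism A -> B},
      g qx = y -> g (qstar qx) = z -> g =1 f].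
Proof.
move=> yz.
have yzX k : y * z ^+ k = (q ^+ k)%:C%C *: (z ^+ k * y).
  elim: k => [|k IHk]; first by rewrite !expr0 mulr1 mul1r scale1r.
  rewrite [in LHS]exprS mulrA yz -scalerAl -mulrA IHk -scalerAr scalerA mulrA.
  by rewrite -!exprS -rmorphM -exprS.
have yXzX n k : y ^+ n * z ^+ k = (q ^+ (n * k))%:C%C *: (z ^+ k * y ^+ n).
  elim: n => [|n IHn]; first by rewrite !expr0 mulr1 mul1r scale1r.
  rewrite [in LHS]exprS -mulrA IHn -scalerAr [y * _]mulrA yzX -scalerAl.
  by rewrite scalerA -mulrA -exprS -rmorphM -exprD mulSn addnC.
pose f : {linear A -> B} := qlin (fun m n => z ^+ m * y ^+ n).
have fM : monoid_morphism f.
  split; first by rewrite /f/= [1]/(qmono 0 0) qlin_mono !expr0 mulr1.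
  move=> a b; move: a.
  apply: (@qlinear_eq B) => [c a a'|c a a'|m n].
  - by rewrite mulrDl -scalerAl linearP.
  - by rewrite linearP mulrDl -scalerAl.
  move: b; apply: (@qlinear_eq B) => [c b b'|c b b'|k l].
  - by rewrite mulrDr -scalerAr linearP.
  - by rewrite linearP mulrDr -scalerAr.
  rewrite qmonoM linearZZ /f/= !qlin_mono.
  rewrite mulrA -(mulrA (z ^+ m)) yXzX -scalerAr -scalerAl.
  by rewrite !exprD !mulrA.
pose F : {lrmorphism A -> B} := HB.pack (GRing.Linear.sort f)
  (GRing.isMonoidMorphism.Build A B (GRing.Linear.sort f) fM).
have Fmono m n : F (qmono m n) = z ^+ m * y ^+ n by exact: qlin_mono.
exists F; split.
- by apply: (etrans (Fmono 0 1)); rewrite expr0 expr1 mul1r.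
- by rewrite /qx qstar_mono; apply: (etrans (Fmono 1 0)); rewrite expr0 mulr1.
move=> g gx gz; apply: qlin_ext => m n; apply/esym.
apply: (etrans (Fmono m n)).
by rewrite qmonoE -gx -gz -!rmorphXn -rmorphM.
Qed.

End QPlane.

(** * Unbounded operators *)

Section Operators.
Variables (R : realType) (H : hilbertType R).

(* Only the values of [app] on [dom] are meaningful. *)
Record partial_op := PartialOp { dom : set H ; app :> H -> H }.

Definition linear_subspace (D : set H) : Prop :=
  D 0 /\ forall (c : R[i]) f g, D f -> D g -> D (c *: f + g).

Definition linear_op (X : partial_op) : Prop :=
  linear_subspace (dom X) /\
  forall (c : R[i]) f g, dom X f -> dom X g -> X (c *: f + g) = c *: X f + X g.

Definition densely_defined (X : partial_op) : Prop := dense (dom X).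

Definition id_op : partial_op := PartialOp setT id.

Definition comp_op (X Y : partial_op) : partial_op :=
  PartialOp [set f | dom Y f /\ dom X (Y f)] (fun f => X (Y f)).

Definition exp_op (X : partial_op) (n : nat) : partial_op :=
  iter n (comp_op X) id_op.

(* [g] is in the domain of the adjoint with value [h]; for a densely defined
   operator [h] is determined by [g]. *)
Definition adjoint_rel (X : partial_op) (g h : H) : Prop :=
  forall f, dom X f -> inner (X f) g = inner f h.

Definition adjoint (X : partial_op) : partial_op :=
  PartialOp [set g | exists h, adjoint_rel X g h]
            (fun g => xget 0 (adjoint_rel X g)).

Definition dom_infty (X : partial_op) : set H :=
  \bigcap_(n in [set n | (0 < n)%N]) dom (exp_op X n).

Definition q_normal (q : R) (X : partial_op) : Prop :=
  [/\ linear_op X,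
      densely_defined X,
      dom X = dom (adjoint X) &
      forall f, dom X f -> `|adjoint X f| = (Num.sqrt q)%:C%C * `|X f| ].

(* The operator f(X, X^* ), i.e. the sum of the alpha_mn X^*m X^n, on the domain
   common to the terms with a nonzero coefficient. *)
Definition eval_op (q : R) (f : qplane q) (X : partial_op) : partial_op :=
  PartialOp
    [set phi | forall m n, qcoef f m n != 0 ->
       dom (comp_op (exp_op (adjoint X) m) (exp_op X n)) phi]
    (fun phi =>
       qlin (fun m n => comp_op (exp_op (adjoint X) m) (exp_op X n) phi) f).

(* A *-representation of the algebra on the dense subspace [rep_dom] of [H];
   only the restrictions of the maps [rep_act a] to [rep_dom] are meaningful. *)
Record star_rep (q : R) := StarRep {
  rep_dom : set H ;
  rep_act :> qplane q -> H -> H ;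
  rep_dom_subspace : linear_subspace rep_dom ;
  rep_dom_dense : dense rep_dom ;
  rep_act_dom : forall a f, rep_dom f -> rep_dom (rep_act a f) ;
  rep_act_linear : forall a (c : R[i]) f g, rep_dom f -> rep_dom g ->
    rep_act a (c *: f + g) = c *: rep_act a f + rep_act a g ;
  rep_linear : forall (c : R[i]) a b f, rep_dom f ->
    rep_act (c *: a + b) f = c *: rep_act a f + rep_act b f ;
  rep_one : forall f, rep_dom f -> rep_act 1 f = f ;
  rep_mul : forall a b f, rep_dom f ->
    rep_act (a * b) f = rep_act a (rep_act b f) ;
  rep_star : forall a f g, rep_dom f -> rep_dom g ->
    inner (rep_act a f) g = inner f (rep_act (qstar a) g)
}.

Definition well_behaved (q : R) (pi : star_rep q) : Prop :=
  exists X : partial_op, [/\ q_normal q X, rep_dom pi = dom_infty X &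
    forall f, rep_dom pi f -> pi (qx q) f = X f].

End Operators.

(** * Moment functionals *)

Section Moments.
Variables (R : realType) (q : R).

(* No condition on the domain of f(X, X^* ) is needed: it contains [dom_infty X]
   when [X] is q-normal. *)
Definition q_positive : set (qplane q) :=
  [set f | qstar f = f /\
    forall (H : hilbertType R) (X : partial_op H), q_normal q X ->
    forall phi : H, dom_infty X phi -> 0 <= inner (eval_op f X phi) phi].

Definition q_moment_functional (F : {scalar (qplane q)}) : Prop :=
  exists (H : hilbertType R) (pi : star_rep H q), well_behaved pi /\
  exists2 xi : H, rep_dom pi xi & forall a, F a = inner (pi a xi) xi.

Definition strongly_positive (F : {scalar (qplane q)}) : Prop :=
  forall a, q_positive a -> 0 <= F a.

End Moments.

(* Main.v *)
Require Import Defs.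
From HB Require Import structures.
From mathcomp Require Import all_boot all_order all_algebra.
From mathcomp Require Import sesquilinear.
From mathcomp Require Import boolp classical_sets functions reals.
From mathcomp Require Import topology normedtype sequences interval_inference.
From mathcomp Require Import complex ring lra.

(** A moment functional is strongly positive because a well-behaved
    representation is determined by its operator: density of the domain forces
    x^* to act as the adjoint of X, so that pi(a) is the sum of the
    alpha_mn X^*m X^n ([well_behaved_act]).

    The converse combines a Hahn-Banach extension with a GNS construction. For
    commuting variables one would extend the functional to functions of
    polynomial growth and represent the extension by a measure. Here neither
    measures nor the spectral theorem are used: a single bounded function of X
    is enough, the resolvent r = (1 + q X^* X)^-1.

    - A q-normal operator X is closed and equal to its second adjoint, and
      X X^* = q X^* X with equal domains ([qn_comm]); projecting onto its graph
      gives the resolvent ([qn_resolvent]). Commuting X past r shows that r maps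
      D^oo(X) to itself without increasing the norms |X^k f|
      ([resolvent_iter]). So every word w in the letters x, x^*, r acts on
      D^oo(X), and |w phi|^2 <= c |X^N phi|^2 where c and N depend on w only
      and not on X or phi ([word_vec_bound]). The right-hand side is the value
      at phi of an element of the algebra.

    - Consider formal combinations of pairs of words (v, w), evaluated at
      (X, phi) to <v phi, w phi>. By the bound each of them is dominated by an
      element of the algebra. The infimum of Re F over the dominating elements
      is therefore a finite sublinear functional, and a linear functional L
      below it ([hahn_banach]) extends F and is positive: whatever equality,
      sign or conjugation holds between combinations at all (X, phi) holds for
      their images under L (the [transfer] lemmas).

    - In particular (v, w) |-> L(v, w) is a positive semidefinite form on
      combinations of words. A Cholesky decomposition maps the combinations to a
      total subset of a space of square-summable sequences, isometrically
      ([embed_inner], [embed_total]). There the letters x and x^* are formally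
      adjoint, satisfy |x^* u|^2 = q |x u|^2, and 1 + q x^* x is onto because
      the letter r inverts it.

    - The closure of the letter x is a q-normal operator. The point is that its
      adjoint is not larger than the closure of x^*: a vector of the graph of
      the adjoint orthogonal to the graph of x^* is orthogonal to the range of
      1 + q x^* x ([closure_adjoint_rel], [closure_q_normal]). The class of the
      empty word lies in D^oo and represents F ([gns_moment]). *)

Set Implicit Arguments.
Unset Strict Implicit.
Unset Printing Implicit Defensive.
Import Order.TTheory GRing.Theory Num.Theory.
Import numFieldNormedType.Exports.
Local Open Scope classical_set_scope.
Local Open Scope ring_scope.

Local Notation Re := (@complex.Re _).
Local Notation Im := (@complex.Im _).

(** * Real and imaginary parts *)
Section Cplx.
Variable R : realType.
Local Notation C := R[i].

Lemma cReD (x y : C) : Re (x + y) = Re x + Re y.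
Proof. by case: x y => ? ? []. Qed.
Lemma cImD (x y : C) : Im (x + y) = Im x + Im y.
Proof. by case: x y => ? ? []. Qed.
Lemma cReN (x : C) : Re (- x) = - Re x. Proof. by case: x. Qed.
Lemma cImN (x : C) : Im (- x) = - Im x. Proof. by case: x. Qed.
Lemma cReM (x y : C) : Re (x * y) = Re x * Re y - Im x * Im y.
Proof. by case: x y => ? ? []. Qed.
Lemma cImM (x y : C) : Im (x * y) = Re x * Im y + Im x * Re y.
Proof. by case: x y => ? ? []. Qed.
Lemma cReJ (x : C) : Re x^* = Re x. Proof. by case: x. Qed.
Lemma cImJ (x : C) : Im x^* = - Im x. Proof. by case: x. Qed.
Definition Re_Im_simp := (cReD, cReN, cReM, cReJ, cImD, cImN, cImM, cImJ).

Lemma complex_ext (x y : C) : Re x = Re y -> Im x = Im y -> x = y.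
Proof. by case: x y => ? ? [? ?] /= -> ->. Qed.

Lemma ge0_Re_Im (x : C) : 0 <= x -> 0 <= Re x /\ Im x = 0.
Proof. by rewrite lecE /= => /andP[/eqP ? ?]. Qed.

Lemma ge0_of_Re_Im (x : C) : 0 <= Re x -> Im x = 0 -> 0 <= x.
Proof. by move=> ? ?; rewrite lecE /=; apply/andP; split; [apply/eqP|]. Qed.

End Cplx.

Lemma linear_fun0 (R : realType) (U W : lmodType R[i]) (f : U -> W) :
  linear f -> f 0 = 0.
Proof.
move=> fl; have := fl 1 0 0; rewrite !scale1r addr0 => e.
by apply: (@addrI _ (f 0)); rewrite addr0 -e.
Qed.

Lemma linear_funB (R : realType) (U W : lmodType R[i]) (f : U -> W) :
  linear f -> {morph f : u v / u - v}.
Proof.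
by move=> fl u v; rewrite [u - v]addrC -[- v]scaleN1r fl scaleN1r addrC.
Qed.

(** * Positive semidefinite Hermitian forms *)
Section PsdForm.
Variables (R : realType) (V : lmodType R[i]).
Local Notation C := R[i].

(** Semidefinite, because the form of the GNS construction has null vectors;
    they are sent to 0 by the map into the Hilbert space. *)
Record psd_form (B : V -> V -> C) : Prop := PsdForm {
  psd_lin : forall c u v w, B (c *: u + v) w = c * B u w + B v w ;
  psd_conj : forall u v, B v u = (B u v)^* ;
  psd_ge0 : forall u, 0 <= B u u }.

Variables (B : V -> V -> C) (psdB : psd_form B).

Lemma psd0l w : B 0 w = 0.
Proof.
have := psd_lin psdB 1 0 0 w; rewrite scale1r addr0 mul1r => h.
by apply: (@addrI _ (B 0 w)); rewrite addr0 -h.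
Qed.

Lemma psdDl u v w : B (u + v) w = B u w + B v w.
Proof. by have := psd_lin psdB 1 u v w; rewrite scale1r mul1r. Qed.

Lemma psdZl c u w : B (c *: u) w = c * B u w.
Proof. by have := psd_lin psdB c u 0 w; rewrite !addr0 psd0l addr0. Qed.

Lemma psdNl u w : B (- u) w = - B u w.
Proof. by rewrite -scaleN1r psdZl mulN1r. Qed.

Lemma psdBl u v w : B (u - v) w = B u w - B v w.
Proof. by rewrite psdDl psdNl. Qed.

Lemma psd0r w : B w 0 = 0.
Proof. by rewrite (psd_conj psdB) psd0l rmorph0. Qed.

Lemma psdDr u v w : B w (u + v) = B w u + B w v.
Proof. by rewrite !(psd_conj psdB _ w) psdDl rmorphD. Qed.

Lemma psdZr c u w : B w (c *: u) = c^* * B w u.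
Proof. by rewrite !(psd_conj psdB _ w) psdZl rmorphM. Qed.

Lemma psdNr u w : B w (- u) = - B w u.
Proof. by rewrite !(psd_conj psdB _ w) psdNl rmorphN. Qed.

Lemma psdBr u v w : B w (u - v) = B w u - B w v.
Proof. by rewrite psdDr psdNr. Qed.

Definition psdE := (psdDl, psdZl, psdNl, psd0l, psdDr, psdZr, psdNr, psd0r).

Definition sqn u : R := Re (B u u).

Lemma sqn_ge0 u : 0 <= sqn u.
Proof. by have /ge0_Re_Im[] := psd_ge0 psdB u. Qed.

Lemma psd_sqn u : B u u = (sqn u)%:C%C.
Proof. by have /ge0_Re_Im[_ i0] := psd_ge0 psdB u; apply: complex_ext. Qed.

Lemma sqnD u v : sqn (u + v) = sqn u + sqn v + 2 * Re (B u v).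
Proof.
by rewrite /sqn !psdE !Re_Im_simp (psd_conj psdB u v) !Re_Im_simp; ring.
Qed.

Lemma sqnN u : sqn (- u) = sqn u.
Proof. by rewrite /sqn !psdE opprK. Qed.

Lemma sqnB u v : sqn (u - v) = sqn u + sqn v - 2 * Re (B u v).
Proof. by rewrite sqnD sqnN psdNr Re_Im_simp; ring. Qed.

Lemma sqnZ c u : sqn (c *: u) = (Re c ^+ 2 + Im c ^+ 2) * sqn u.
Proof. by rewrite {1}/sqn !psdE psd_sqn !Re_Im_simp /=; ring. Qed.

(** The square of u - t <u, v> v is nonnegative for all real t; a null vector
    v needs a large t, any other v the optimal t = 1 / <v, v>. *)
Lemma psd_cauchy_schwarz u v :
  Re (B u v) ^+ 2 + Im (B u v) ^+ 2 <= sqn u * sqn v.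
Proof.
set a := Re (B u v); set b := Im (B u v).
have key (t : R) : 0 <= sqn u - 2 * t * (a ^+ 2 + b ^+ 2) +
    t ^+ 2 * (a ^+ 2 + b ^+ 2) * sqn v.
  have := sqn_ge0 (u - (t%:C%C * B u v) *: v).
  rewrite sqnB sqnZ psdZr; rewrite !Re_Im_simp /= -/a -/b => h.
  apply: le_trans h _; rewrite le_eqVlt; apply/orP; left; apply/eqP.
  by rewrite /a /b; ring.
have [v0|v0] := eqVneq (sqn v) 0.
  rewrite v0 mulr0 leNgt; apply/negP => ab0.
  set s := a ^+ 2 + b ^+ 2 in ab0 key *.
  have := key ((sqn u + 1) / s).
  rewrite v0 mulr0 addr0 (_ : 2 * _ * s = 2 * (sqn u + 1)); last first.
    by field; rewrite gt_eqF.
  by have := sqn_ge0 u; lra.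
have v_gt0 : 0 < sqn v by rewrite lt_def v0 sqn_ge0.
have := key (sqn v)^-1.
set s := a ^+ 2 + b ^+ 2.
rewrite (_ : _ + _ = sqn u - s / sqn v); last by field.
by rewrite subr_ge0 ler_pdivrMr.
Qed.

(** Null vectors are orthogonal to everything, so a semidefinite form behaves
    as an inner product on the quotient without forming it. *)
Lemma psd_null u v : sqn u = 0 -> B u v = 0.
Proof.
move=> u0; have := psd_cauchy_schwarz u v; rewrite u0 mul0r => h.
have a0 := sqr_ge0 (Re (B u v)); have b0 := sqr_ge0 (Im (B u v)).
apply: complex_ext => /=; apply/eqP; rewrite -sqrf_eq0 eq_le; lra.
Qed.

Definition form_norm u : R := Num.sqrt (sqn u).

Lemma form_norm_ge0 u : 0 <= form_norm u. Proof. exact: sqrtr_ge0. Qed.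

Lemma form_normK u : form_norm u ^+ 2 = sqn u.
Proof. by rewrite sqr_sqrtr// sqn_ge0. Qed.

Lemma Re_le_form_norm u v : Re (B u v) <= form_norm u * form_norm v.
Proof.
apply: le_trans (ler_norm _) _.
rewrite -sqrtr_sqr /form_norm -sqrtrM ?sqn_ge0// ler_sqrt ?mulr_ge0 ?sqn_ge0//.
apply: le_trans (psd_cauchy_schwarz u v).
by rewrite lerDl sqr_ge0.
Qed.

Lemma form_normD u v : form_norm (u + v) <= form_norm u + form_norm v.
Proof.
rewrite -(@ler_pXn2r _ 2)// ?nnegrE ?addr_ge0 ?form_norm_ge0//.
rewrite form_normK sqnD sqrrD !form_normK -mulr_natl.
by have := Re_le_form_norm u v; lra.
Qed.

Lemma form_normZ c u : (form_norm (c *: u))%:C%C = `|c| * (form_norm u)%:C%C.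
Proof.
rewrite /form_norm sqnZ sqrtrM ?addr_ge0 ?sqr_ge0//.
by rewrite rmorphM /= normc_def.
Qed.

(** When the pivot <e, e> vanishes its inverse is 0, and so is the term; this
    is the right value because e is then a null vector. *)
Definition schur_term (e u v : V) : C := B u e * (B v e)^* / B e e.

(** Subtracting the term amounts to evaluating the form at the component of u
    orthogonal to e. *)
Lemma schur_complement_psd e : psd_form (fun u v => B u v - schur_term e u v).
Proof.
split=> [c u v w|u v|u].
- by rewrite /schur_term !psdE; ring.
- rewrite /schur_term rmorphB /= -(psd_conj psdB u v); congr (_ - _).
  rewrite !rmorphM /= conjCK [B v e * _]mulrC; congr (_ * _).
  by rewrite fmorphV /= -(psd_conj psdB).
have [e0|e0] := eqVneq (B e e) 0.
  by rewrite /schur_term e0 invr0 mulr0 subr0 psd_ge0.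
have := psd_ge0 psdB (u - (B u e / B e e) *: e).
rewrite !psdE (_ : _ + _ = B u u - schur_term e u u)// /schur_term.
rewrite rmorphM fmorphV /= -(psd_conj psdB e e) (psd_conj psdB u e) .
by field.
Qed.

Lemma schur_complement_pivot e v : B e v - schur_term e e v = 0.
Proof.
have [e0|e0] := eqVneq (B e e) 0.
  have s0 : sqn e = 0 by rewrite /sqn e0.
  by rewrite /schur_term e0 invr0 mulr0 subr0 (psd_null v s0).
by rewrite /schur_term -(psd_conj psdB) mulrAC mulfV// mul1r subrr.
Qed.

End PsdForm.

(** * Square-summable sequences supported on a set of indices *)
Section L2.
Variables (R : realType) (J : pred nat).
Local Notation C := R[i].

Definition sqmod (z : C) : R := Re z ^+ 2 + Im z ^+ 2.

Lemma sqmod_ge0 z : 0 <= sqmod z.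
Proof. by rewrite addr_ge0 ?sqr_ge0. Qed.

(** Bounded partial sums rather than a convergent series: bounds are simpler
    to establish, and the terms being nonnegative they imply convergence. *)
Definition square_summable : {pred nat -> C} := fun f =>
  `[< (forall k, ~~ J k -> f k = 0) /\
      exists M, forall n, \sum_(k < n) sqmod (f k) <= M >].

Lemma square_summable_cvg (f g : nat -> C) (u : nat -> R) :
  f \in square_summable -> g \in square_summable ->
  (forall k, `|u k| <= sqmod (f k) + sqmod (g k)) -> cvgn (series u).
Proof.
move=> /asboolP[_ [M fM]] /asboolP[_ [N gN]] ufg.
apply: normed_cvg; apply: nondecreasing_is_cvgn.
  by apply: nondecreasing_series => n _ _; exact: normr_ge0.
exists (M + N) => _ [n _ <-]; rewrite /= seriesEord /=.
apply: le_trans (lerD (fM n) (gN n)).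
by rewrite -big_split; apply: ler_sum => k _; exact: ufg.
Qed.

Lemma square_summable_submod : submod_closed square_summable.
Proof.
split.
  apply/asboolP; split=> //; exists 0 => n.
  by rewrite big1// => k _; rewrite /sqmod /= expr0n addr0.
move=> c f g /asboolP[f0 [M fM]] /asboolP[g0 [N gN]]; apply/asboolP; split.
  by move=> k Jk; rewrite !fctE f0// g0// scaler0 addr0.
exists (2 * (sqmod c * M + N)) => n.
apply: (@le_trans _ _ (\sum_(k < n) 2 * (sqmod c * sqmod (f k) + sqmod (g k)))).
  apply: ler_sum => k _; rewrite !fctE /sqmod /GRing.scale /= !Re_Im_simp.
  set a := Re c; set b := Im c; set x := Re (f k); set y := Im (f k).
  set z := Re (g k); set w := Im (g k).
  rewrite -subr_ge0.
  rewrite (_ : _ - _ = (a * x - b * y - z) ^+ 2 + (a * y + b * x - w) ^+ 2).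
    by rewrite addr_ge0 ?sqr_ge0.
  by ring.
rewrite -mulr_sumr big_split -mulr_sumr /= ler_wpM2l//.
apply: lerD; last exact: gN.
by rewrite ler_wpM2l ?sqmod_ge0 ?fM.
Qed.

HB.instance Definition _ := GRing.isSubmodClosed.Build C (nat -> C)
  square_summable square_summable_submod.

Record l2 := L2 { l2val :> nat -> C ; l2P : l2val \in square_summable }.

HB.instance Definition _ := [isSub of l2 for l2val].
HB.instance Definition _ := [Choice of l2 by <:].
HB.instance Definition _ := [SubChoice_isSubLmodule of l2 by <:].


Lemma l2BE (f g : l2) k : (f - g) k = f k - g k.
Proof. by []. Qed.

Definition l2_inner (f g : l2) : C :=
  Complex (limn (series (fun k => Re (f k * (g k)^*))))
          (limn (series (fun k => Im (f k * (g k)^*)))).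

Lemma l2_cvg_Re (f g : l2) : cvgn (series (fun k => Re (f k * (g k)^*))).
Proof.
apply: (square_summable_cvg (l2P f) (l2P g)) => k.
rewrite /sqmod !Re_Im_simp ler_norml.
set a := Re (f k); set b := Im (f k); set c := Re (g k); set d := Im (g k).
have h1 := sqr_ge0 (a + c); have h2 := sqr_ge0 (b + d).
have h3 := sqr_ge0 (a - c); have h4 := sqr_ge0 (b - d).
apply/andP; split; lra.
Qed.

Lemma l2_cvg_Im (f g : l2) : cvgn (series (fun k => Im (f k * (g k)^*))).
Proof.
apply: (square_summable_cvg (l2P f) (l2P g)) => k.
rewrite /sqmod !Re_Im_simp ler_norml.
set a := Re (f k); set b := Im (f k); set c := Re (g k); set d := Im (g k).
have h1 := sqr_ge0 (a + d); have h2 := sqr_ge0 (b + c).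
have h3 := sqr_ge0 (a - d); have h4 := sqr_ge0 (b - c).
apply/andP; split; lra.
Qed.


Lemma cvgn_comb (a b : R) (u v w : nat -> R) (lu lv lw : R) :
  u @ \oo --> lu -> v @ \oo --> lv -> w @ \oo --> lw ->
  (fun n => a * u n + b * v n + w n) @ \oo --> a * lu + b * lv + lw.
Proof.
move=> ul vl wl; apply: cvgD => //.
by apply: cvgD; apply: cvgM => //; exact: cvg_cst.
Qed.

Lemma lim_series_comb (a b : R) (u v w x : nat -> R) :
  (forall k, x k = a * u k + b * v k + w k) ->
  cvgn (series u) -> cvgn (series v) -> cvgn (series w) ->
  limn (series x) =
  a * limn (series u) + b * limn (series v) + limn (series w).
Proof.
move=> xE cu cv cw; apply/cvg_lim => //.
rewrite (_ : series x =
  (fun n => a * series u n + b * series v n + series w n)).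
  exact: cvgn_comb.
apply/funext => n; rewrite /series /= !mulr_sumr -!big_split.
by apply: eq_bigr => k _; rewrite xE.
Qed.

Lemma l2_inner_psd : psd_form l2_inner.
Proof.
split=> [c f g h|f g|f].
- apply: complex_ext; rewrite !Re_Im_simp /= -?mulNr.
    apply: lim_series_comb; rewrite ?mulNr; [|exact: l2_cvg_Re|
      exact: l2_cvg_Im|exact: l2_cvg_Re].
    by move=> k; rewrite !fctE /GRing.scale /= !Re_Im_simp; ring.
  apply: lim_series_comb; [|exact: l2_cvg_Im|
      exact: l2_cvg_Re|exact: l2_cvg_Im].
  by move=> k; rewrite !fctE /GRing.scale /= !Re_Im_simp; ring.
- apply: complex_ext; rewrite !Re_Im_simp /=.
    by congr (limn (series _)); apply/funext => k; rewrite !Re_Im_simp; ring.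
  rewrite -lim_seriesN; last exact: l2_cvg_Im.
  by congr (limn (series _)); apply/funext => k; rewrite fctE !Re_Im_simp; ring.
apply: ge0_of_Re_Im => /=.
  apply: limr_ge; first exact: l2_cvg_Re.
  near=> n; rewrite sumr_ge0// => k _; rewrite !Re_Im_simp.
  by rewrite mulrN opprK -!expr2 addr_ge0 ?sqr_ge0.
rewrite (_ : (fun _ => _) = (fun _ => 0)); last first.
  by apply/funext => k; rewrite !Re_Im_simp; ring.
apply/cvg_lim => //; rewrite (_ : series _ = (fun _ => 0)).
  exact: cvg_cst.
by apply/funext => n; rewrite /series /= big1.
Unshelve. all: by end_near. Qed.

Lemma l2_partial_le (f : l2) n : \sum_(k < n) sqmod (f k) <= sqn l2_inner f.
Proof.
have -> : \sum_(k < n) sqmod (f k) = series (fun k => Re (f k * (f k)^*)) n.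
  rewrite seriesEord; apply: eq_bigr => k _.
  by rewrite /sqmod !Re_Im_simp; ring.
apply: nondecreasing_cvgn_le; last exact: l2_cvg_Re.
apply: nondecreasing_series => k _ _; rewrite !Re_Im_simp.
by rewrite mulrN opprK -!expr2 addr_ge0 ?sqr_ge0.
Qed.

Lemma l2_sqn_le (f : l2) M :
  (forall n, \sum_(k < n) sqmod (f k) <= M) -> sqn l2_inner f <= M.
Proof.
move=> fM; apply: limr_le; first exact: l2_cvg_Re.
near=> n; apply: le_trans (fM n); rewrite seriesEord.
by apply: ler_sum => k _; rewrite /sqmod !Re_Im_simp lerD// mulrN opprK.
Unshelve. all: by end_near. Qed.

Lemma sqmod_le0 z : sqmod z <= 0 -> z = 0.
Proof.
rewrite /sqmod => h; have a0 := sqr_ge0 (Re z); have b0 := sqr_ge0 (Im z).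
by apply: complex_ext => /=; apply/eqP; rewrite -sqrf_eq0 eq_le; lra.
Qed.

Lemma l2_coord_le (f : l2) k : sqmod (f k) <= sqn l2_inner f.
Proof.
apply: le_trans (l2_partial_le f k.+1); rewrite big_ord_recr /= lerDr.
by apply: sumr_ge0 => i _; exact: sqmod_ge0.
Qed.

Lemma l2_sqn_eq0 (f : l2) : sqn l2_inner f = 0 -> f = 0.
Proof.
move=> f0; apply/val_inj/funext => k /=; apply: sqmod_le0.
by rewrite -f0; exact: l2_coord_le.
Qed.

Definition l2_norm (f : l2) : C := (form_norm l2_inner f)%:C%C.

Lemma l2_normD f g : l2_norm (f + g) <= l2_norm f + l2_norm g.
Proof. by rewrite -rmorphD lecR; exact: (form_normD l2_inner_psd). Qed.

Lemma l2_normZ (c : C) f : l2_norm (c *: f) = `|c| * l2_norm f.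
Proof. exact: (form_normZ l2_inner_psd). Qed.

Lemma l2_norm_eq0 f : l2_norm f = 0 -> f = 0.
Proof.
move=> /complexI f0; apply: l2_sqn_eq0.
by rewrite -(form_normK l2_inner_psd) f0 expr0n.
Qed.

HB.instance Definition _ := Lmodule_isNormed.Build C l2
  l2_normD l2_normZ l2_norm_eq0.


Lemma real_seq_cvg (a : nat -> R) :
  (forall n m, `|a n - a m| <= n.+1%:R^-1 + m.+1%:R^-1) -> cvgn a.
Proof.
move=> aC; apply/cauchy_cvgP/cauchy_exP => e e0.
have [N _ NP] := near_infty_natSinv_lt (PosNum (divr_gt0 e0 (ltr0Sn R 1))).
exists (a N); exists N => // n /= Nn; rewrite /ball /=.
apply: le_lt_trans (aC N n) _.
by rewrite (splitr e) ltrD//; apply: NP => /=.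
Qed.

Lemma l2_re_le (f : l2) k : `|Re (f k)| <= form_norm l2_inner f.
Proof.
rewrite -(@ler_pXn2r _ 2) ?nnegrE ?form_norm_ge0// (form_normK l2_inner_psd).
rewrite real_normK ?num_real//; apply: le_trans (l2_coord_le f k).
by rewrite lerDl sqr_ge0.
Qed.

Lemma l2_im_le (f : l2) k : `|Im (f k)| <= form_norm l2_inner f.
Proof.
rewrite -(@ler_pXn2r _ 2) ?nnegrE ?form_norm_ge0// (form_normK l2_inner_psd).
rewrite real_normK ?num_real//; apply: le_trans (l2_coord_le f k).
by rewrite lerDr sqr_ge0.
Qed.

(** The limit is taken coordinatewise; it is square-summable and a limit in
    norm because the partial sums of the squared distances pass to the
    limit. *)
Lemma l2_seq_complete (x : nat -> l2) :
  (forall n m, form_norm l2_inner (x n - x m) <= n.+1%:R^-1 + m.+1%:R^-1) ->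
  exists l : l2, forall n, form_norm l2_inner (x n - l) <= 2 * n.+1%:R^-1.
Proof.
move=> xC.
have cRe k : cvgn (fun n => Re (x n k)).
  apply: real_seq_cvg => n m; apply: le_trans (xC n m).
  by have := l2_re_le (x n - x m) k; rewrite l2BE !Re_Im_simp.
have cIm k : cvgn (fun n => Im (x n k)).
  apply: real_seq_cvg => n m; apply: le_trans (xC n m).
  by have := l2_im_le (x n - x m) k; rewrite l2BE !Re_Im_simp.
pose l k : C :=
  Complex (limn (fun n => Re (x n k))) (limn (fun n => Im (x n k))).
have bound n N : \sum_(k < N) sqmod (x n k - l k) <= (2 * n.+1%:R^-1) ^+ 2.
  have lim_sum : (fun m => \sum_(k < N) sqmod (x n k - x m k)) @ \oo -->
      \sum_(k < N) sqmod (x n k - l k).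
    have h (u : nat -> R) a b : u @ \oo --> b ->
        (fun m => (a - u m) ^+ 2) @ \oo --> (a - b) ^+ 2.
      move=> ub; rewrite expr2; under eq_fun do rewrite expr2.
      by apply: cvgM; apply: cvgB => //; exact: cvg_cst.
    elim: N => [|N IHN].
      rewrite big_ord0; under eq_fun do rewrite big_ord0; exact: cvg_cst.
    rewrite big_ord_recr /=; under eq_fun do rewrite big_ord_recr /=.
    apply: cvgD => //; rewrite /sqmod; under eq_fun do rewrite !Re_Im_simp.
    by rewrite !Re_Im_simp; apply: cvgD; apply: h; [exact: cRe|exact: cIm].
  apply: (cvgr_to_le lim_sum); exists n => // m /= nm.
  have := l2_partial_le (x n - x m) N => /le_trans; apply.
  rewrite -(form_normK l2_inner_psd) ler_pXn2r ?nnegrE ?form_norm_ge0//.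
  apply: le_trans (xC n m) _; rewrite mulr_natl mulr2n lerD2l.
  by rewrite lef_pV2 ?posrE// ler_nat.
have dP n : (fun k => x n k - l k) \in square_summable.
  apply/asboolP; split; last by eexists => N; exact: bound.
  move=> k Jk.
  have z m : x m k = 0 by have /asboolP[+ _] := l2P (x m); apply.
  rewrite z /l (_ : (fun m => Re (x m k)) = fun _ => 0); last first.
    by apply/funext => m; rewrite z.
  rewrite (_ : (fun m => Im (x m k)) = fun _ => 0); last first.
    by apply/funext => m; rewrite z.
  by rewrite !lim_cst// subr0.
have lP : l \in square_summable.
  rewrite (_ : l = l2val (x 0) - (fun k => x 0 k - l k)).
    by rewrite rpredB ?l2P.
  by apply/funext => k; rewrite !fctE subKr.
exists (L2 lP) => n; rewrite -(@ler_pXn2r _ 2) ?nnegrE ?form_norm_ge0//.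
rewrite (form_normK l2_inner_psd); apply: l2_sqn_le => N; exact: bound.
Qed.


(** The centres of balls of radius 1 / (n + 1) belonging to F form a sequence
    whose limit is the limit of F. *)
Lemma l2_complete (F : set_system l2) : ProperFilter F -> cauchy F -> cvg F.
Proof.
move=> FF /cauchyP Fc.
have inv_gt0 n : (0 : C) < (n.+1%:R^-1 : R)%:C%C by rewrite ltcR invr_gt0.
pose x n := projT1 (cid (Fc _ (inv_gt0 n))).
have xP n : F (ball (x n) (n.+1%:R^-1 : R)%:C%C).
  by rewrite /x; case: cid.
have ballE (f g : l2) (e : R) : ball f e%:C%C g ->
  form_norm l2_inner (f - g) < e.
  by rewrite -ball_normE /ball_ /= ltcR.
have [n m|l lP] := @l2_seq_complete x.
  have [z [/ballE xz /ballE yz]] := filter_ex (filterI (xP n) (xP m)).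
  rewrite (_ : x n - x m = (x n - z) - (x m - z)); last first.
    by rewrite opprB addrA subrK.
  apply: le_trans (form_normD l2_inner_psd _ _) _.
  apply: lerD; first exact: ltW.
  apply/ltW; apply: le_lt_trans yz.
  by rewrite /form_norm (sqnN l2_inner_psd).
apply/cvg_ex; exists l; apply/cvgrPdist_lt => e e_gt0.
have [e0 _] := ge0_Re_Im (ltW e_gt0); move: e_gt0;
  rewrite ltcE => /andP[/eqP/= ie re].
have [N _ NP] := near_infty_natSinv_lt (PosNum (divr_gt0 re (ltr0Sn R 2))).
apply: filterS (xP N) => z /ballE xz.
rewrite (_ : e = (complex.Re e)%:C%C); last exact: complex_ext.
rewrite ltcR (_ : l - z = (x N - z) - (x N - l)); last first.
  by rewrite opprB [RHS]addrC addrA subrK.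
apply: le_lt_trans (form_normD l2_inner_psd _ _) _.
rewrite {2}/form_norm (sqnN l2_inner_psd) -/(form_norm _ _).
have := lP N; have /= := NP N (leqnn N); move: xz.
rewrite ltr_pdivlMr//.
by move: (form_norm _ _) (form_norm _ _) (N.+1%:R^-1) => a b r; lra.
Qed.

HB.instance Definition _ := Uniform_isComplete.Build l2 l2_complete.


Lemma l2_inner_linearl (h : l2) : linear_for *%R (l2_inner^~ h).
Proof. by move=> c f g; exact: psd_lin l2_inner_psd c f g h. Qed.

Lemma l2_inner_linearr (h : l2) :
  linear_for (Num.conj \; *%R) (l2_inner h).
Proof.
by move=> c f g; rewrite (psdDr l2_inner_psd) (psdZr l2_inner_psd).
Qed.

HB.instance Definition _ := bilinear_isBilinear.Build C l2 l2 C
  *%R (Num.conj \; *%R) l2_inner (l2_inner_linearl, l2_inner_linearr).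

Lemma l2_inner_herm (f g : l2) :
  l2_inner f g = (-1) ^+ false * Num.conj (l2_inner g f).
Proof. by rewrite expr0 mul1r; exact: psd_conj l2_inner_psd g f. Qed.

HB.instance Definition _ := isHermitianSesquilinear.Build C l2 false
  (Num.conj : C -> C) l2_inner l2_inner_herm.

Lemma l2_inner_gt0 (f : l2) : f != 0 -> 0 < l2_inner f f.
Proof.
move=> f0; rewrite (psd_sqn l2_inner_psd) ltcR lt_def.
rewrite (sqn_ge0 l2_inner_psd) andbT.
by apply: contraNneq f0 => /l2_sqn_eq0 ->.
Qed.

HB.instance Definition _ := isDotProduct.Build C l2 l2_inner l2_inner_gt0.

Lemma l2_sqr_norm (f : l2) : `|f| ^+ 2 = l2_inner f f.
Proof.
rewrite (psd_sqn l2_inner_psd) -(form_normK l2_inner_psd) rmorphXn.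
by [].
Qed.

HB.instance Definition _ := CompleteNormedModule_isHilbert.Build R l2
  l2_sqr_norm.

Lemma inner_l2E (f g : l2) : inner f g = l2_inner f g.
Proof. by []. Qed.

End L2.

Section L2fin.
Variables (R : realType) (J : pred nat).
Local Notation C := R[i].

Lemma lim_series_fin (u : nat -> R) N : (forall k, (N <= k)%N -> u k = 0) ->
  limn (series u) = \sum_(k < N) u k.
Proof.
move=> u0; apply/cvg_lim => //; apply: cvg_near_cst; exists N => // n /= Nn.
rewrite seriesEnat /= (@big_cat_nat _ _ _ N)//= [X in _ + X]big_nat_cond.
rewrite [X in _ + X]big1 ?addr0 ?big_mkord// => k.
by rewrite andbT => /andP[/u0 ->].
Qed.

Lemma Re_sum (I : finType) (F : I -> C) : Re (\sum_i F i) = \sum_i Re (F i).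
Proof. by apply: (big_morph (@complex.Re R)) => // x y; rewrite cReD. Qed.

Lemma Im_sum (I : finType) (F : I -> C) : Im (\sum_i F i) = \sum_i Im (F i).
Proof. by apply: (big_morph (@complex.Im R)) => // x y; rewrite cImD. Qed.

Lemma l2_inner_fin (f g : l2 R J) N : (forall k, (N <= k)%N -> g k = 0) ->
  l2_inner f g = \sum_(k < N) f k * (g k)^*.
Proof.
move=> g0; have z k : (N <= k)%N -> f k * (g k)^* = 0.
  by move=> /g0 ->; rewrite rmorph0 mulr0.
apply: complex_ext; rewrite /= ?Re_sum ?Im_sum; apply: lim_series_fin => k /z.
  by move=> ->.
by move=> ->.
Qed.
End L2fin.

(** * Cholesky decomposition of a form on polynomials *)
Section Cholesky.
Variables (R : realType).
Local Notation C := R[i].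
Local Notation V := {poly C}.
Variables (B : V -> V -> C) (psdB : psd_form B).

(** The form left after n steps of the Cholesky decomposition along the
    monomials: the Schur complement with respect to the first n of them. *)
Fixpoint residual (n : nat) : V -> V -> C :=
  if n is n'.+1 then fun u v =>
    residual n' u v - schur_term (residual n') 'X^n' u v else B.

Lemma residual_psd n : psd_form (residual n).
Proof. by elim: n => //= n IHn; exact: schur_complement_psd. Qed.

Definition pivot n : R := form_norm (residual n) 'X^n.

(** A vanishing pivot gives the coordinate 0, its inverse being 0. *)
Definition coord n (u : V) : C := residual n u 'X^n / (pivot n)%:C%C.

Lemma schur_coord n u v : schur_term (residual n) 'X^n u v =
  coord n u * (coord n v)^*.
Proof.
rewrite /coord rmorphM fmorphV /=.
have -> : ((pivot n)%:C%C : C)^* = (pivot n)%:C%C by exact: conjc_real.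
rewrite /schur_term (psd_sqn (residual_psd n)) -(form_normK (residual_psd n))
  -/(pivot n).
by rewrite rmorphXn /= expr2 invfM; ring.
Qed.

Lemma cholesky_sum n u v :
  B u v = \sum_(k < n) coord k u * (coord k v)^* + residual n u v.
Proof.
elim: n => [|n IHn] /=; first by rewrite big_ord0 add0r.
by rewrite big_ord_recr /= -schur_coord IHn; ring.
Qed.

Lemma residual_Xn n k v : (k < n)%N -> residual n 'X^k v = 0.
Proof.
elim: n v => // n IHn v; rewrite ltnS leq_eqVlt => /orP[/eqP ->|kn] /=.
  exact: (schur_complement_pivot (residual_psd n)).
by rewrite IHn// /schur_term IHn// !mul0r subrr.
Qed.

Lemma coordP k (c : C) (u v : V) : coord k (c *: u + v) =
  c * coord k u + coord k v.
Proof. by rewrite /coord (psd_lin (residual_psd k)); ring. Qed.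

(** Monomials already used as pivots are null for the residual form, so the
    decomposition of a polynomial is exact after finitely many steps. *)
Lemma residual_size n (u v : V) : (size u <= n)%N -> residual n u v = 0.
Proof.
move=> un; rewrite -[u]coefK poly_def.
elim/big_ind: _ => [|p p' p0 p'0|i _]; first exact: (psd0l (residual_psd n)).
  by rewrite (psdDl (residual_psd n)) p0 p'0 addr0.
rewrite (psdZl (residual_psd n)) residual_Xn ?mulr0//.
by rewrite (leq_trans (ltn_ord i)).
Qed.

Lemma coord_size k (u : V) : (size u <= k)%N -> coord k u = 0.
Proof. by move=> uk; rewrite /coord residual_size// mul0r. Qed.

(** Coordinates with a zero pivot vanish identically. Discarding them makes
    the image of the embedding total. *)
Definition pivots : pred nat := fun k => pivot k != 0.

Lemma coord_square_summable (u : V) :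
  (fun k => coord k u) \in @square_summable R pivots.
Proof.
apply/asboolP; split=> [k|]; first by rewrite negbK /coord => /eqP ->;
  rewrite invr0 mulr0.
exists (Re (B u u)) => n; rewrite (cholesky_sum n) cReD Re_sum.
rewrite [leLHS](_ : _ = \sum_(i < n) Re (coord i u * (coord i u)^*)).
  by rewrite lerDl (sqn_ge0 (residual_psd n)).
by apply: eq_bigr => k _; rewrite /sqmod !Re_Im_simp; ring.
Qed.

Definition embed u : l2 R pivots := L2 (coord_square_summable u).

Lemma embed_linear (c : C) u v : embed (c *: u + v) = c *: embed u + embed v.
Proof. by apply/val_inj/funext => k /=; exact: coordP. Qed.

Lemma embed_inner (u v : V) : inner (embed u) (embed v) = B u v.
Proof.
rewrite inner_l2E (@l2_inner_fin _ _ _ _ (size v)) => [|k];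
  last exact: coord_size.
by rewrite (cholesky_sum (size v)) (psd_conj (residual_psd _)) residual_size//
  rmorph0 addr0.
Qed.

(** The matrix of coordinates is triangular with nonzero diagonal on the
    pivots, so orthogonality to the monomials kills the coordinates of f one
    after the other. *)
Lemma embed_total (f : l2 R pivots) :
  (forall u, inner f (embed u) = 0) -> f = 0.
Proof.
move=> f0; apply/val_inj/funext => k /=.
elim/ltn_ind: k => k IHk.
have [pk|pk] := boolP (pivots k); last by have /asboolP[+ _] := l2P f; exact.
have := f0 'X^k; rewrite inner_l2E (@l2_inner_fin _ _ _ _ k.+1) => [|i].
  rewrite big_ord_recr /= big1 ?add0r => [|i _]; last by rewrite IHk ?mul0r.
  move=> /eqP; rewrite mulf_eq0 => /orP[/eqP//|].
  rewrite conjC_eq0 /coord (psd_sqn (residual_psd k)) -(form_normK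
    (residual_psd k)).
  have pC : ((pivot k)%:C%C : C) != 0.
    by apply: contraNneq pk => /complexI ->.
  by rewrite -/(pivot k) rmorphXn /= expr2 mulfK// (negbTE pC).
by rewrite /= => ki; apply: coord_size; rewrite size_polyXn.
Qed.
End Cholesky.

(** * Convergence and orthogonal projection for a semidefinite form *)
Section Proj.
Variables (R : realType) (V : lmodType R[i]) (B : V -> V -> R[i]).
Hypothesis psdB : psd_form B.
Local Notation C := R[i].

(** Convergence of sequences for the seminorm of the form, with squared
    distances to avoid square roots. *)
Definition form_cvg (x : nat -> V) (l : V) := forall e : R, 0 < e ->
  exists N, forall n, (N <= n)%N -> sqn B (x n - l) < e.

Definition form_cauchy (x : nat -> V) := forall e : R, 0 < e ->
  exists N, forall n m, (N <= n)%N -> (N <= m)%N -> sqn B (x n - x m) < e.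

Lemma inv_nat_small (e : R) : 0 < e -> exists N, forall n, (N <= n)%N ->
  n.+1%:R^-1 < e.
Proof.
by move=> e0; have [N _ NP] := near_infty_natSinv_lt (PosNum e0); exists N.
Qed.

(** The square of u - s v is nonnegative. *)
Lemma sqn_young s u v : 2 * s * Re (B u v) <= sqn B u + s ^+ 2 * sqn B v.
Proof.
have := sqn_ge0 psdB (u - s%:C%C *: v).
rewrite (sqnB psdB) (sqnZ psdB) (psdZr psdB) !Re_Im_simp /=; lra.
Qed.

Lemma parallelogram u v :
  sqn B (u + v) + sqn B (u - v) = 2 * sqn B u + 2 * sqn B v.
Proof. by rewrite (sqnD psdB) (sqnB psdB); ring. Qed.

(** A minimizing sequence for the distance from p to K is Cauchy by the
    parallelogram law, and perturbing its limit along v shows that the real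
    part of B (p - g) v cannot be positive. *)
Lemma psd_projection (K : set V) :
  K 0 -> (forall (c : C) u v, K u -> K v -> K (c *: u + v)) ->
  (forall x, (forall n, K (x n)) -> form_cauchy x ->
    exists2 l, K l & form_cvg x l) ->
  forall p, exists2 g, K g & forall v, K v -> B (p - g) v = 0.
Proof.
move=> K0 KL Kc p.
have KD u v : K u -> K v -> K (u + v).
  by move=> Ku Kv; rewrite -[u]scale1r; exact: KL.
have KZ c u : K u -> K (c *: u).
  by move=> Ku; rewrite -[_ *: _]addr0; exact: KL.
pose S := [set sqn B (p - g) | g in K].
have S_inf : has_inf S.
  split; first by exists (sqn B (p - 0)), 0.
  by exists 0 => _ [g _ <-]; exact: sqn_ge0.
pose m := inf S.
have m_le g : K g -> m <= sqn B (p - g).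
  by move=> Kg; apply: ge_inf; [exact: S_inf.2|exists g].
have gex n : {g | K g /\ sqn B (p - g) < m + n.+1%:R^-1}.
  apply: cid; have n0 : (0 : R) < n.+1%:R^-1 by rewrite invr_gt0.
  by have [_ [g Kg <-] ?] := inf_adherent n0 S_inf; exists g.
pose g n := sval (gex n).
have Kg n : K (g n) by rewrite /g; case: (gex n) => ? [].
have gm n : sqn B (p - g n) < m + n.+1%:R^-1.
  by rewrite /g; case: (gex n) => ? [].
have [|l Kl gl] := Kc g Kg.
  move=> e e0; have e4 : 0 < e / 4 by lra.
  have [N NP] := inv_nat_small e4; exists N => n n' Nn Nn'.
  have gn := gm n; have gn' := gm n'.
  have /m_le mid : K ((2%:R^-1 : R)%:C%C *: (g n + g n')) by apply/KZ/KD.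
  have := parallelogram (p - g n) (p - g n').
  rewrite (_ : p - g n + (p - g n') =
      (2 : R)%:C%C *: (p - (2%:R^-1 : R)%:C%C *: (g n + g n'))); last first.
    rewrite scalerBr scalerA -rmorphM mulfV ?pnatr_eq0// scale1r.
    by rewrite rmorph_nat scaler_nat mulr2n opprD addrACA.
  rewrite (_ : p - g n - (p - g n') = - (g n - g n')); last first.
    by rewrite !opprB [LHS]addrC addrA subrK.
  rewrite (sqnN psdB) (sqnZ psdB) /=.
  move: gn gn' (NP _ Nn) (NP _ Nn') mid.
  by move: (n.+1%:R^-1) (n'.+1%:R^-1) => i i'; lra.
exists l => //.
(* The bound s r <= e + s^2 k for all e > 0 and s > 0 excludes r > 0. *)
have le0 v : K v -> Re (B (p - l) v) <= 0.
  move=> Kv; rewrite leNgt; apply/negP => r0.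
  set r := Re _ in r0; pose k := sqn B v.
  have k0 : 0 <= k by exact: sqn_ge0.
  have small s e : 0 < s -> 0 < e -> s * r <= e + s ^+ 2 * k.
    move=> s0 e0; have [N1 N1P] := inv_nat_small e0.
    have [N2 N2P] := gl _ e0; pose n := maxn N1 N2.
    have h1 := N1P n (leq_maxl _ _); have h2 := N2P n (leq_maxr _ _).
    have h3 := gm n.
    have h4 := m_le _ (KD _ _ (Kg n) (KZ s%:C%C _ Kv)).
    rewrite opprD addrA (sqnB psdB) (sqnZ psdB) (psdZr psdB) !Re_Im_simp /=
      -/k in h4.
    have h5 := sqn_young s (g n - l) v; rewrite -/k in h5.
    have rE : r = Re (B (p - g n) v) + Re (B (g n - l) v).
      by rewrite -cReD -(psdDl psdB) addrA subrK.
    by move: h1 h2 h3 h4 h5; rewrite rE; move: (n.+1%:R^-1) => i; lra.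
  (* k + 1 rather than k, which may vanish; then s^2 k <= s r / 2. *)
  pose s := r / (2 * (k + 1)).
  have s0 : 0 < s by rewrite divr_gt0//; lra.
  have sr : 0 < s * r by rewrite mulr_gt0.
  have e0 : 0 < s * r / 4 by lra.
  have := small s _ s0 e0; rewrite leNgt => /negP; apply.
  have -> : s ^+ 2 * k = s * r / 2 * (k / (k + 1)).
    by rewrite /s; field; rewrite gt_eqF//; lra.
  have : k / (k + 1) <= 1 by rewrite ler_pdivrMr; lra.
  by set y := _ / _ => y1; nra.
have eq0 v : K v -> Re (B (p - l) v) = 0.
  move=> Kv; apply/eqP; rewrite eq_le le0//=.
  have := le0 _ (KZ (-1) _ Kv).
  by rewrite scaleN1r (psdNr psdB) Re_Im_simp oppr_le0.
move=> v Kv; apply: complex_ext; first exact: eq0.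
have := eq0 _ (KZ 'i%C _ Kv).
by rewrite (psdZr psdB) !Re_Im_simp /= => h; rewrite /=; lra.
Qed.

(** The continuity of the form in its first argument, packaged for passing an
    identity between two sequences to the limit. *)
Lemma form_cvg_eq (x y : nat -> V) f g v w : form_cvg x f -> form_cvg y g ->
  (forall n, B (x n) v = B (y n) w) -> B f v = B g w.
Proof.
move=> xf yg xy; apply/eqP; rewrite -subr_eq0; apply/eqP/sqmod_le0.
rewrite leNgt; apply/negP => d0.
set d := B f v - B g w in d0.
pose M := sqn B v + sqn B w + 1.
have M0 : 0 < M by rewrite /M ltr_wpDl// addr_ge0// sqn_ge0.
have e0 : 0 < sqmod d / (4 * M) by rewrite divr_gt0// mulr_gt0.
have [N1 N1P] := xf _ e0; have [N2 N2P] := yg _ e0; pose n := maxn N1 N2.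
have h1 := N1P n (leq_maxl _ _); have h2 := N2P n (leq_maxr _ _).
have dE : d = B (y n - g) w - B (x n - f) v.
  by rewrite /d !(psdBl psdB) xy; ring.
have c1 := psd_cauchy_schwarz psdB (y n - g) w.
have c2 := psd_cauchy_schwarz psdB (x n - f) v.
have b1 : sqn B (y n - g) * sqn B w <= sqmod d / (4 * M) * sqn B w.
  by rewrite ler_wpM2r ?sqn_ge0// ltW.
have b2 : sqn B (x n - f) * sqn B v <= sqmod d / (4 * M) * sqn B v.
  by rewrite ler_wpM2r ?sqn_ge0// ltW.
have b3 :
    sqmod d / (4 * M) * sqn B w + sqmod d / (4 * M) * sqn B v < sqmod d / 4.
  rewrite -mulrDr (_ : _ / 4 = sqmod d / (4 * M) * M); last first.
    by field; rewrite gt_eqF.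
  by rewrite ltr_pM2l// /M; lra.
have : sqmod d <= 2 * (Re (B (y n - g) w) ^+ 2 + Im (B (y n - g) w) ^+ 2) +
    2 * (Re (B (x n - f) v) ^+ 2 + Im (B (x n - f) v) ^+ 2).
  rewrite dE /sqmod !Re_Im_simp.
  set a := Re _; set b := Re _; set c := Im _; set z := Im _.
  by have := sqr_ge0 (a + b); have := sqr_ge0 (c + z); lra.
lra.
Qed.

Lemma form_cvg_cauchy x l : form_cvg x l -> form_cauchy x.
Proof.
move=> xl e e0; have e4 : 0 < e / 4 by lra.
have [N NP] := xl _ e4; exists N => n m Nn Nm.
rewrite (_ : x n - x m = (x n - l) - (x m - l)); last first.
  by rewrite opprB addrA subrK.
have := parallelogram (x n - l) (x m - l).
have := sqn_ge0 psdB ((x n - l) + (x m - l)).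
by have := NP _ Nn; have := NP _ Nm; lra.
Qed.

Lemma form_cvg_comb (c : C) x y f g : form_cvg x f -> form_cvg y g ->
  form_cvg (fun n => c *: x n + y n) (c *: f + g).
Proof.
move=> xf yg e e0.
pose M := sqmod c + 1.
have M0 : 0 < M by rewrite /M ltr_wpDl// sqmod_ge0.
have e1 : 0 < e / (4 * M) by rewrite divr_gt0// mulr_gt0.
have e4 : 0 < e / 4 by lra.
have [N1 N1P] := xf _ e1; have [N2 N2P] := yg _ e4.
exists (maxn N1 N2) => n; rewrite geq_max => /andP[/N1P h1 /N2P h2].
rewrite (_ : _ - _ = c *: (x n - f) + (y n - g)); last first.
  by rewrite scalerBr opprD addrACA.
have := parallelogram (c *: (x n - f)) (y n - g).
have := sqn_ge0 psdB (c *: (x n - f) - (y n - g)).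
rewrite (sqnZ psdB) -/(sqmod c).
have : sqmod c * sqn B (x n - f) <= e / 4.
  rewrite (_ : e / 4 = M * (e / (4 * M))); last first.
    by field; rewrite gt_eqF.
  by rewrite ler_pM ?sqmod_ge0 ?sqn_ge0// ?ltW// /M ltrDl.
lra.
Qed.

End Proj.

(** * Hilbert spaces *)
Section Hilb.
Variables (R : realType) (H : hilbertType R).
Local Notation C := R[i].
Local Notation ip := (@inner R H : H -> H -> C).

Lemma inner_psd : psd_form ip.
Proof.
split=> [c u v w|u v|u].
- by rewrite linearDl linearZl_LR.
- by rewrite hermC expr0 mul1r.
- by rewrite -sqr_norm_inner exprn_ge0.
Qed.

Lemma normE (f : H) : `|f| = (form_norm ip f)%:C%C.
Proof.
have : `|f| ^+ 2 = ((form_norm ip f)%:C%C : C) ^+ 2.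
  rewrite sqr_norm_inner (psd_sqn inner_psd) -(form_normK inner_psd).
  by rewrite rmorphXn.
by move=> /eqP; rewrite eqrXn2 ?ler0c ?form_norm_ge0// => /eqP.
Qed.

Lemma sqn_lt (f : H) (e : R) : 0 < e -> (sqn ip f < e ^+ 2) = (`|f| < e%:C%C).
Proof.
move=> e0; rewrite normE ltcR -(form_normK inner_psd).
by rewrite ltr_pXn2r ?nnegrE ?form_norm_ge0// ltW.
Qed.

Lemma complex_gt0 (e : C) : 0 < e -> exists2 r : R, 0 < r & e = r%:C%C.
Proof.
rewrite ltcE /= => /andP[/eqP i0 r0]; exists (Re e) => //.
exact: complex_ext.
Qed.

Lemma hilbert_complete x : form_cauchy ip x -> exists l, form_cvg ip x l.
Proof.
move=> xc.
have /cauchy_cvg /cvg_ex[l xl] : cauchy (x @ \oo).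
  apply/cauchyP => e /complex_gt0[r r0 ->].
  have [N NP] := xc _ (exprn_gt0 2 r0); exists (x N), N => // n /= Nn.
  by rewrite -ball_normE /ball_ /= -sqn_lt//; exact: NP.
exists l => e e0; have s0 : 0 < Num.sqrt e by rewrite sqrtr_gt0.
have sC : (0 : C) < (Num.sqrt e)%:C%C by rewrite ltcR.
have /cvgrPdist_lt /(_ _ sC)[N _ NP] := xl.
exists N => n Nn; rewrite -(sqr_sqrtr (ltW e0)) sqn_lt// distrC.
exact: NP.
Qed.

Lemma dense_approx (D : set H) : dense D ->
  forall f e, 0 < e -> exists2 v, D v & sqn ip (v - f) < e.
Proof.
move=> dD f e e0; have s0 : 0 < Num.sqrt e by rewrite sqrtr_gt0.
have sC : (0 : C) < (Num.sqrt e)%:C%C by rewrite ltcR.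
have [|v []] := dD (ball f (Num.sqrt e)%:C%C) _ (ball_open _ _).
  by exists f; exact: ballxx.
rewrite -ball_normE /ball_ /= => fv Dv; exists v => //.
by rewrite -(sqr_sqrtr (ltW e0)) sqn_lt// distrC.
Qed.

Lemma approx_dense (D : set H) :
  (forall f e, 0 < e -> exists2 v, D v & sqn ip (v - f) < e) -> dense D.
Proof.
move=> aD O [f Of] oO.
have /nbhs_ballP[e /= /complex_gt0[r r0 ->] eO] := open_nbhs_nbhs (conj oO Of).
have [v Dv fv] := aD f _ (exprn_gt0 2 r0).
exists v; split=> //; apply: eO; rewrite -ball_normE /ball_ /= distrC.
by rewrite -sqn_lt.
Qed.

Lemma sqn_eq0 f : sqn ip f = 0 -> f = 0.
Proof.
move=> f0; apply/eqP; rewrite -normr_eq0 normE /form_norm f0 sqrtr0.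
by [].
Qed.

Lemma dense_orth (D : set H) f : dense D -> (forall v, D v -> ip f v = 0) ->
  f = 0.
Proof.
move=> dD f0; apply: sqn_eq0; apply/eqP;
  rewrite eq_le (sqn_ge0 inner_psd) andbT.
rewrite leNgt; apply/negP => fgt; have [v Dv] := dense_approx dD f fgt.
rewrite (sqnB inner_psd) (psd_conj inner_psd f v) f0// rmorph0 /=.
by have := sqn_ge0 inner_psd v; lra.
Qed.

(** An adjoint is determined by its values against a dense domain. *)
Lemma dense_inj (D : set H) f g : dense D ->
  (forall v, D v -> ip f v = ip g v) -> f = g.
Proof.
move=> dD fg; apply/eqP; rewrite -subr_eq0; apply/eqP/(dense_orth dD) => v Dv.
by rewrite (psdBl inner_psd) fg// subrr.
Qed.

(** With the weight t, projecting onto the graph of an operator X inverts the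
    operator 1 + t X^* X. *)
Definition pair_form (t : R) (u v : H * H) : C :=
  ip u.1 v.1 + t%:C%C * ip u.2 v.2.

Lemma pair_form_psd t : 0 <= t -> psd_form (pair_form t).
Proof.
move=> t0; split=> [c u v w|u v|u]; rewrite /pair_form.
- by rewrite /= !(psdE inner_psd); ring.
- rewrite rmorphD rmorphM /= -!(psd_conj inner_psd).
  by congr (_ + _ * _); symmetry; exact: conjc_real.
- by rewrite addr_ge0 ?mulr_ge0 ?(psd_ge0 inner_psd)// ler0c.
Qed.

Lemma sqn_pair t u : sqn (pair_form t) u = sqn ip u.1 + t * sqn ip u.2.
Proof. by rewrite /sqn /pair_form !Re_Im_simp /= mul0r subr0. Qed.

(** The case of [psd_projection] used for operators: a closed graph is
    complete for the weighted form. *)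
Lemma graph_projection t (K : set (H * H)) : 0 < t ->
  K 0 -> (forall (c : C) u v, K u -> K v -> K (c *: u + v)) ->
  (forall x f h, (forall n, K (x n)) -> form_cvg ip (fun n => (x n).1) f ->
     form_cvg ip (fun n => (x n).2) h -> K (f, h)) ->
  forall f h, exists2 g, K g &
    forall v, K v -> ip (f - g.1) v.1 + t%:C%C * ip (h - g.2) v.2 = 0.
Proof.
move=> t0 K0 KL Kc f h.
have [//|//||g Kg gP] :=
  psd_projection (pair_form_psd (ltW t0)) (K := K) _ _ _ (f, h);
  last by exists g.
move=> x Kx xc.
have xc1 : form_cauchy ip (fun n => (x n).1).
  move=> e e0; have [N NP] := xc e e0; exists N => n m Nn Nm.
  apply: le_lt_trans (NP n m Nn Nm); rewrite sqn_pair lerDl.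
  by rewrite mulr_ge0 ?(sqn_ge0 inner_psd)// ltW.
have xc2 : form_cauchy ip (fun n => (x n).2).
  move=> e e0; have [N NP] := xc _ (mulr_gt0 t0 e0); exists N => n m Nn Nm.
  rewrite -(ltr_pM2l t0); apply: le_lt_trans (NP n m Nn Nm).
  by rewrite sqn_pair lerDr (sqn_ge0 inner_psd).
have [l1 xl1] := hilbert_complete xc1; have [l2 xl2] := hilbert_complete xc2.
exists (l1, l2); first exact: Kc xl1 xl2.
move=> e e0; have e2 : 0 < e / 2 by lra.
have et : 0 < e / 2 / t by rewrite divr_gt0.
have [N1 N1P] := xl1 _ e2; have [N2 N2P] := xl2 _ et.
exists (maxn N1 N2) => n; rewrite geq_max => /andP[/N1P h1 /N2P h2].
rewrite sqn_pair /=; move: h2; rewrite ltr_pdivlMr// mulrC => h2.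
by move: h1 h2; lra.
Qed.

End Hilb.

(** * q-normal operators and their resolvents *)
Section QNormal.
Variables (R : realType) (q : R) (q_gt0 : 0 < q) (H : hilbertType R).
Variables (X : partial_op H) (qX : q_normal q X).
Local Notation C := R[i].
Local Notation ip := (@inner R H : H -> H -> C).
Local Notation D := (dom X).
Local Notation Y := (adjoint X).

Lemma qn_dom0 : D 0. Proof. by case: qX => -[[]]. Qed.

Lemma qn_domP (c : C) f g : D f -> D g -> D (c *: f + g).
Proof. by case: qX => -[[_ +] _ _ _ _]; apply. Qed.

Lemma qn_domD f g : D f -> D g -> D (f + g).
Proof. by move=> Df Dg; rewrite -[f]scale1r; exact: qn_domP. Qed.

Lemma qn_domZ (c : C) f : D f -> D (c *: f).
Proof. by move=> Df; rewrite -[_ *: _]addr0; apply: qn_domP => //;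
  exact: qn_dom0. Qed.

Lemma qn_domB f g : D f -> D g -> D (f - g).
Proof. by move=> Df Dg; rewrite -scaleN1r addrC; exact: qn_domP. Qed.

Lemma qn_linP (c : C) f g : D f -> D g -> X (c *: f + g) = c *: X f + X g.
Proof. by case: qX => -[_ +] _ _ _; apply. Qed.

Lemma qn_0 : X 0 = 0.
Proof.
have := qn_linP 1 qn_dom0 qn_dom0; rewrite !scale1r addr0 => h.
by apply: (@addrI _ (X 0)); rewrite addr0 -h.
Qed.

Lemma qn_Z (c : C) f : D f -> X (c *: f) = c *: X f.
Proof.
move=> Df; have := qn_linP c Df qn_dom0.
by rewrite qn_0 !addr0.
Qed.

Lemma qn_D f g : D f -> D g -> X (f + g) = X f + X g.
Proof. by move=> Df Dg; have := qn_linP 1 Df Dg; rewrite !scale1r. Qed.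

Lemma qn_B f g : D f -> D g -> X (f - g) = X f - X g.
Proof.
by move=> Df Dg; rewrite addrC -scaleN1r qn_linP// scaleN1r addrC.
Qed.

Lemma qn_dense : dense D. Proof. by case: qX. Qed.

Lemma qn_domadj g : D g -> dom Y g. Proof. by case: qX => _ _ <-. Qed.

Lemma qn_adj f g : D f -> D g -> ip (X f) g = ip f (Y g).
Proof.
move=> Df /qn_domadj[h hP]; apply: (xgetPex 0 _ : adjoint_rel X g (Y g)) => //.
by exists h.
Qed.

(** The equality of the domains of X and of its adjoint is what makes g a
    vector of D. *)
Lemma qn_adj_intro g h : (forall f, D f -> ip (X f) g = ip f h) ->
  D g /\ Y g = h.
Proof.
move=> gh; have Dg : D g by case: qX => _ _ -> _; exists h.
split=> //; apply: (dense_inj qn_dense) => f Df.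
by rewrite !(psd_conj (inner_psd H) f) -qn_adj// gh.
Qed.

Lemma qn_adjP (c : C) f g : D f -> D g -> Y (c *: f + g) = c *: Y f + Y g.
Proof.
move=> Df Dg; apply: (qn_adj_intro _).2 => u Du.
by rewrite !(psdE (inner_psd H)) !qn_adj.
Qed.

Lemma qn_adj0 : Y 0 = 0.
Proof.
by apply: (qn_adj_intro _).2 => u Du; rewrite !(psd0r (inner_psd H)).
Qed.

Lemma qn_adjZ (c : C) f : D f -> Y (c *: f) = c *: Y f.
Proof.
move=> Df; have := qn_adjP c Df qn_dom0.
by rewrite qn_adj0 !addr0.
Qed.

Lemma qn_adjB f g : D f -> D g -> Y (f - g) = Y f - Y g.
Proof.
by move=> Df Dg; rewrite addrC -scaleN1r qn_adjP// scaleN1r addrC.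
Qed.

Lemma qn_sqn f : D f -> sqn ip (Y f) = q * sqn ip (X f).
Proof.
case: qX => _ _ _ /[apply].
rewrite !normE -rmorphM => /complexI yx.
rewrite -!(form_normK (inner_psd H)) yx exprMn sqr_sqrtr//; exact: ltW.
Qed.

(** Polarization of the equality of norms defining q-normality. *)
Lemma qn_inner f g : D f -> D g -> ip (Y f) (Y g) = q%:C%C * ip (X f) (X g).
Proof.
have psd := inner_psd H.
have re u v : D u -> D v -> Re (ip (Y u) (Y v)) = q * Re (ip (X u) (X v)).
  move=> Du Dv; have := qn_sqn (qn_domD Du Dv).
  have YD : Y (u + v) = Y u + Y v.
    by have := qn_adjP 1 Du Dv; rewrite !scale1r.
  by rewrite YD qn_D// !(sqnD psd) !qn_sqn//; lra.
move=> Df Dg; apply: complex_ext; rewrite !Re_Im_simp /= mul0r.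
  by rewrite re// subr0.
have := re _ _ Df (qn_domZ 'i%C Dg).
rewrite qn_adjZ// qn_Z// !(psdZr psd) !Re_Im_simp /= addr0; lra.
Qed.

(** Adjoints are closed, and the equality of norms makes the graph norms of X
    and of its adjoint equivalent. *)
Lemma qn_closed x f h : (forall n, D (x n)) -> form_cvg ip x f ->
  form_cvg ip (fun n => X (x n)) h -> D f /\ X f = h.
Proof.
move=> Dx xf xh; have psd := inner_psd H.
have [l yl] : exists l, form_cvg ip (fun n => Y (x n)) l.
  apply: hilbert_complete => e e0.
  have [N NP] := form_cvg_cauchy psd xh (divr_gt0 e0 q_gt0).
  exists N => n m Nn Nm; have := NP n m Nn Nm.
  rewrite -qn_B// -qn_adjB// qn_sqn; last exact: qn_domB.
  by rewrite ltr_pdivlMr// mulrC.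
have [Df Yf] : D f /\ Y f = l.
  apply: qn_adj_intro => u Du.
  rewrite !(psd_conj psd _ (X u)) !(psd_conj psd _ u); congr (_^*).
  apply: (form_cvg_eq psd xf yl) => n.
  by rewrite !(psd_conj psd (X u)) !(psd_conj psd u) qn_adj.
split=> //; apply/eqP; rewrite -subr_eq0; apply/eqP/sqn_eq0.
have xfX : form_cvg ip (fun n => X (x n)) (X f).
  move=> e e0; have [N NP] := yl _ (mulr_gt0 q_gt0 e0).
  exists N => n /NP; rewrite -Yf.
  rewrite -qn_B// -qn_adjB// qn_sqn; last exact: qn_domB.
  by rewrite ltr_pM2l.
by rewrite /sqn (psdBl psd) (form_cvg_eq psd xfX xh (fun n => erefl)) subrr.
Qed.

Lemma qn_graph_projection t : 0 < t -> forall f h, exists2 g, D g &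
  forall v, D v -> ip (f - g) v + t%:C%C * ip (h - X g) (X v) = 0.
Proof.
move=> t0 f h.
have [||x y z xK xy xz|[g k] [/= Dg <-] gP] :=
    graph_projection t0 (K := [set u : H * H | D u.1 /\ X u.1 = u.2]) _ _ _ f h.
- by split; [exact: qn_dom0|exact: qn_0].
- move=> c u v [Du Xu] [Dv Xv]; split; first exact: qn_domP.
  by rewrite /= qn_linP// Xu Xv.
- apply: (qn_closed (x := fun n => (x n).1)) => [n||]//;
  first by have [] := xK n.
  by under eq_fun do rewrite (xK _).2.
by exists g => // v Dv; have := gP (v, X v); apply.
Qed.

(** X is its own second adjoint: the component (a, b) of (k, l) orthogonal to
    the graph of X satisfies Y b = - a, hence <a, a> = - <b, b> if (k, l) lies
    in the graph of the adjoint of Y. *)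
Lemma qn_bidual k l : (forall u, D u -> ip (Y u) k = ip u l) -> D k /\ X k = l.
Proof.
move=> kl; have psd := inner_psd H.
have [g Dg gP] := qn_graph_projection ltr01 k l.
(* (k - g, l - X g) is orthogonal to the graph of X. *)
have [Dl Yl] : D (l - X g) /\ Y (l - X g) = - (k - g).
  apply: qn_adj_intro => v Dv; have := gP v Dv.
  rewrite mul1r => /eqP; rewrite addr_eq0 => /eqP h.
  by rewrite (psdNr psd) (psd_conj psd _ v) h rmorphN /= opprK -(psd_conj psd).
have sq : ip (Y (l - X g)) (k - g) = ip (l - X g) (l - X g).
  rewrite (psdBr psd) kl// [X in _ - X](_ : _ = ip (l - X g) (X g)).
    by rewrite -(psdBr psd).
  by rewrite (psd_conj psd g) -qn_adj// -(psd_conj psd).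
move: sq; rewrite Yl (psdNl psd) => /(congr1 Re); rewrite cReN => sq.
have a0 := sqn_ge0 psd (k - g); have b0 := sqn_ge0 psd (l - X g).
rewrite -/(sqn ip _) -/(sqn ip _) in sq.
have /sqn_eq0/eqP : sqn ip (k - g) = 0 by lra.
have /sqn_eq0/eqP : sqn ip (l - X g) = 0 by lra.
by rewrite !subr_eq0 => /eqP -> /eqP ->.
Qed.

(** By polarization u |-> <Y u, Y f> = q <X u, X f> = q <u, Y (X f)> is
    continuous, so Y f is in the domain of the second adjoint, which is X. *)
Lemma qn_comm f : D f -> D (X f) -> D (Y f) /\ X (Y f) = q%:C%C *: Y (X f).
Proof.
move=> Df DXf; apply: qn_bidual => u Du; have psd := inner_psd H.
rewrite qn_inner// (psdZr psd) qn_adj//.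
by congr (_ * _); symmetry; exact: conjc_real.
Qed.

Lemma qn_comm_conv f : D f -> D (Y f) -> D (X f).
Proof.
move=> Df DYf; have psd := inner_psd H.
have [] // := @qn_adj_intro (X f) (q^-1%:C%C *: X (Y f)) => u Du.
have := qn_inner Du Df.
have -> : ip (Y u) (Y f) = ip u (X (Y f)).
  by rewrite (psd_conj psd (Y f)) -qn_adj// -(psd_conj psd).
move=> h; rewrite (psdZr psd) h.
have -> : (q^-1%:C%C : C)^* = q^-1%:C%C by exact: conjc_real.
by rewrite mulrA -rmorphM mulVf ?gt_eqF// mul1r.
Qed.

(** Projecting (f, 0) onto the graph of X for the form with weight s gives (g,
    X g) with <f - g, v> = s <X g, X v> for all v, i.e. s Y (X g) = f - g. *)
Lemma qn_resolvent s f : 0 < s -> exists2 g, D g /\ D (X g) &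
  g + s%:C%C *: Y (X g) = f.
Proof.
move=> s0; have psd := inner_psd H.
have [g Dg gP] := qn_graph_projection s0 f 0.
have [DXg YXg] : D (X g) /\ Y (X g) = s^-1%:C%C *: (f - g).
  apply: qn_adj_intro => v Dv; have := gP v Dv.
  rewrite sub0r (psdNl psd) mulrN => /eqP; rewrite subr_eq0 => /eqP h.
  rewrite (psdZr psd) (psd_conj psd (f - g)) h rmorphM /= -(psd_conj psd) mulrA.
  have -> : (s^-1%:C%C : C)^* = s^-1%:C%C by exact: conjc_real.
  have -> : (s%:C%C : C)^* = s%:C%C by exact: conjc_real.
  by rewrite -rmorphM mulVf ?gt_eqF// mul1r.
exists g => //.
by rewrite YXg scalerA -rmorphM mulfV ?gt_eqF// scale1r addrC subrK.
Qed.

End QNormal.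

(** * The action of the algebra on the smooth domain *)
Section QNormalInf.
Variables (R : realType) (q : R) (q_gt0 : 0 < q) (H : hilbertType R).
Variables (X : partial_op H) (qX : q_normal q X).
Local Notation C := R[i].
Local Notation ip := (@inner R H : H -> H -> C).
Local Notation D := (dom X).
Local Notation Y := (adjoint X).
Local Notation A := (qplane q).

(** The domain of X^n unfolded from the first application of X, the form
    suited to induction; [exp_op] composes on the other side. *)
Fixpoint pow_dom n f := if n is n'.+1 then D f /\ pow_dom n' (X f) else True.

Lemma pow_domP n (c : C) f g : pow_dom n f -> pow_dom n g ->
  pow_dom n (c *: f + g).
Proof.
elim: n f g => //= n IHn f g [Df Xf] [Dg Xg]; split.
  exact: (qn_domP qX).
by rewrite (qn_linP qX)//; exact: IHn.
Qed.

Lemma pow_dom0 n : pow_dom n 0.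
Proof.
by elim: n => //= n IHn; split; [exact: (qn_dom0 qX)|rewrite (qn_0 qX)].
Qed.

Lemma pow_domZ n (c : C) f : pow_dom n f -> pow_dom n (c *: f).
Proof.
by move=> Df; rewrite -[_ *: _]addr0; apply: pow_domP => //; exact: pow_dom0.
Qed.

Lemma pow_dom_recr n f : pow_dom n.+1 f <-> pow_dom n f /\ D (iter n X f).
Proof.
elim: n f => [|n IHn] f; first by split=> [[]|[]].
rewrite iterSr; split.
  by move=> [Df /IHn[? ?]]; do !split.
by move=> [[Df XDf] DX]; split=> //; apply/IHn.
Qed.

Lemma exp_opE (T : partial_op H) n f : exp_op T n f = iter n T f.
Proof. by elim: n => //= n ->. Qed.

Lemma exp_op_dom n f : dom (exp_op X n) f <-> pow_dom n f.
Proof.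
elim: n => // n IHn; rewrite pow_dom_recr.
by rewrite -exp_opE; split=> -[/IHn].
Qed.

Lemma dom_inftyP f : dom_infty X f <-> forall n, pow_dom n f.
Proof.
split=> [fX [//|n]|fX n _]; last exact/exp_op_dom.
by apply/exp_op_dom; exact: fX.
Qed.

Lemma dinf_dom f : dom_infty X f -> D f.
Proof. by move=> /dom_inftyP/(_ 1)[]. Qed.

Lemma dinf0 : dom_infty X 0.
Proof. by apply/dom_inftyP => n; exact: pow_dom0. Qed.

Lemma dinfP (c : C) f g : dom_infty X f -> dom_infty X g ->
  dom_infty X (c *: f + g).
Proof.
by move=> /dom_inftyP f1 /dom_inftyP g1; apply/dom_inftyP => n; exact: pow_domP.
Qed.

Lemma dinfZ (c : C) f : dom_infty X f -> dom_infty X (c *: f).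
Proof. by move=> /dom_inftyP f1; apply/dom_inftyP => n; exact: pow_domZ. Qed.

Lemma dinfD f g : dom_infty X f -> dom_infty X g -> dom_infty X (f + g).
Proof. by move=> f1 g1; rewrite -[f]scale1r; exact: dinfP. Qed.

Lemma dinfX f : dom_infty X f -> dom_infty X (X f).
Proof. by move=> /dom_inftyP f1; apply/dom_inftyP => n; have [] := f1 n.+1. Qed.

Lemma pow_dom_adj n f : pow_dom n.+1 f -> pow_dom n (Y f).
Proof.
elim: n f => // n IHn f [Df [DXf XXf]].
have [DYf XYf] := qn_comm q_gt0 qX Df DXf.
by split=> //; rewrite XYf; apply: pow_domZ; exact: IHn.
Qed.

Lemma dinfY f : dom_infty X f -> dom_infty X (Y f).
Proof. by move=> /dom_inftyP f1; apply/dom_inftyP => n; exact: pow_dom_adj. Qed.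

Lemma dinf_comm f : dom_infty X f -> X (Y f) = q%:C%C *: Y (X f).
Proof.
by move=> f1; apply: (qn_comm q_gt0 qX _ _).2; apply: dinf_dom => //;
  exact: dinfX.
Qed.

Lemma dinf_iterX n f : dom_infty X f -> dom_infty X (iter n X f).
Proof. by move=> f1; elim: n => //= n; exact: dinfX. Qed.

Lemma dinf_iterY n f : dom_infty X f -> dom_infty X (iter n Y f).
Proof. by move=> f1; elim: n => //= n; exact: dinfY. Qed.

Definition mono_op m n f := iter m Y (iter n X f).

Lemma dinf_mono m n f : dom_infty X f -> dom_infty X (mono_op m n f).
Proof. by move=> f1; apply/dinf_iterY/dinf_iterX. Qed.

Lemma mono_opP m n (c : C) f g : dom_infty X f -> dom_infty X g ->
  mono_op m n (c *: f + g) = c *: mono_op m n f + mono_op m n g.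
Proof.
move=> f1 g1; rewrite /mono_op.
have -> : iter n X (c *: f + g) = c *: iter n X f + iter n X g.
  elim: n => //= n ->; apply: (qn_linP qX); apply: dinf_dom; exact: dinf_iterX.
elim: m => //= m ->; apply: (qn_adjP qX); apply: dinf_dom;
  by apply/dinf_iterY/dinf_iterX.
Qed.

Lemma X_iterY k f : dom_infty X f ->
  X (iter k Y f) = (q ^+ k)%:C%C *: iter k Y (X f).
Proof.
move=> f1; elim: k => [|k IHk] /=; first by rewrite expr0 scale1r.
rewrite dinf_comm; last exact: dinf_iterY.
rewrite IHk (qn_adjZ qX); last by apply/dinf_dom/dinf_iterY/dinfX.
by rewrite scalerA -rmorphM -exprS.
Qed.

Lemma iterX_iterY n k f : dom_infty X f ->
  iter n X (iter k Y f) = (q ^+ (n * k))%:C%C *: iter k Y (iter n X f).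
Proof.
move=> f1; elim: n => [|n IHn] /=; first by rewrite expr0 scale1r.
rewrite IHn (qn_Z qX); last by apply/dinf_dom/dinf_iterY/dinf_iterX.
rewrite X_iterY; last exact: dinf_iterX.
by rewrite scalerA -rmorphM -exprD mulSn addnC.
Qed.

Lemma mono_opM m n k l f : dom_infty X f -> mono_op m n (mono_op k l f) =
  (q ^+ (n * k))%:C%C *: mono_op (m + k) (n + l) f.
Proof.
move=> f1; rewrite /mono_op iterX_iterY; last exact: dinf_iterX.
rewrite -iterD; set v := iter k Y _.
have v1 : dom_infty X v by apply/dinf_iterY/dinf_iterX.
have -> : iter m Y ((q ^+ (n * k))%:C%C *: v) =
  (q ^+ (n * k))%:C%C *: iter m Y v.
  elim: m => [//|m IHm]; rewrite iterS IHm (qn_adjZ qX)//.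
  by apply: dinf_dom; exact: dinf_iterY.
by rewrite /v -iterD.
Qed.

Lemma mono_op_adj m n f g : dom_infty X f -> dom_infty X g ->
  ip (mono_op m n f) g = ip f (mono_op n m g).
Proof.
move=> f1 g1; have psd := inner_psd H.
have aX k u v : dom_infty X u -> dom_infty X v ->
    ip (iter k X u) v = ip u (iter k Y v).
  move=> u1; elim: k v => [//|k IHk] v v1.
  rewrite iterS iterSr (qn_adj qX); first by apply: IHk; exact: dinfY.
    by apply: dinf_dom; exact: dinf_iterX.
  exact: dinf_dom.
rewrite /mono_op (psd_conj psd g) -aX//; last exact: dinf_iterX.
rewrite -(psd_conj psd) aX//; exact: dinf_iterX.
Qed.

(** On D^oo all monomials are defined, so the domain condition of [eval_op]
    holds for every element of the algebra. *)
Definition act (a : A) (f : H) : H := eval_op a X f.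

Lemma actE a f : act a f = qlin (fun m n => mono_op m n f) a.
Proof.
by apply: eq_qlin => m n /=; rewrite !exp_opE.
Qed.

Lemma act_dinf a f : dom_infty X f -> dom_infty X (act a f).
Proof.
move=> f1; rewrite actE /qlin.
elim/big_ind: _ => [|u v|i _]; [exact: dinf0|exact: dinfD|].
elim/big_ind: _ => [|u v|j _]; [exact: dinf0|exact: dinfD|].
by apply: dinfZ; exact: dinf_mono.
Qed.

Lemma act_lin a (c : C) f g : dom_infty X f -> dom_infty X g ->
  act a (c *: f + g) = c *: act a f + act a g.
Proof.
move=> f1 g1; rewrite !actE -qlin_comb.
by apply: eq_qlin => m n; exact: mono_opP.
Qed.

Lemma act_linl (c : C) a b f : act (c *: a + b) f = c *: act a f + act b f.
Proof. by rewrite !actE linearP. Qed.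

Lemma act_mono m n f : act (qmono q m n) f = mono_op m n f.
Proof. by rewrite actE qlin_mono. Qed.

Lemma act1 f : act 1 f = f.
Proof. exact: (act_mono 0 0). Qed.

Lemma actM a b f : dom_infty X f -> act (a * b) f = act a (act b f).
Proof.
move=> f1; move: a; apply: (@qlinear_eq R q H) => [c a a'|c a a'|m n].
- by rewrite mulrDl -scalerAl act_linl.
- by rewrite act_linl.
move: b; apply: (@qlinear_eq R q H) => [c b b'|c b b'|k l].
- by rewrite mulrDr -scalerAr act_linl.
- by rewrite act_linl !act_mono mono_opP//; exact: act_dinf.
by rewrite qmonoM -[_ *: _]addr0 act_linl !act_mono mono_opM// actE linear0
  addr0.
Qed.

Lemma act_star a f g : dom_infty X f -> dom_infty X g ->
  ip (act a f) g = ip f (act (qstar a) g).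
Proof.
move=> f1 g1; have psd := inner_psd H.
move: a; apply: (@qlinear_eq R q C^o) => [c a a'|c a a'|m n].
- by rewrite act_linl (psd_lin psd).
- by rewrite qstar_comb act_linl (psdDr psd) (psdZr psd) conjCK.
by rewrite qstar_mono !act_mono mono_op_adj.
Qed.

(** The induction is over all s: if g + s Y X g = f then X g satisfies the
    same equation with s q in place of s and X f in place of f. The norm bound
    comes from |f|^2 = |g|^2 + 2 s |X g|^2 + s^2 |Y X g|^2. *)
Lemma resolvent_iter n s g f : 0 < s -> D g -> D (X g) ->
  g + s%:C%C *: Y (X g) = f -> pow_dom n f ->
  pow_dom n g /\ forall k, (k <= n)%N ->
    sqn ip (iter k X g) <= sqn ip (iter k X f).
Proof.
have psd := inner_psd H.
have base u v t : 0 < t -> D u -> D (X u) -> u + t%:C%C *: Y (X u) = v ->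
    sqn ip u <= sqn ip v.
  move=> t0 Du DXu <-; rewrite (sqnD psd) (sqnZ psd) (psdZr psd).
  rewrite -(qn_adj qX)// (psd_sqn psd (X u)) !Re_Im_simp /=.
  have a0 : 0 <= t * sqn ip (X u) by rewrite mulr_ge0 ?(sqn_ge0 psd)// ltW.
  have b0 : 0 <= t ^+ 2 * sqn ip (Y (X u)).
    by rewrite mulr_ge0 ?sqr_ge0// (sqn_ge0 psd).
  by move: b0; rewrite /=; lra.
elim: n s g f => [|n IHn] s g f s0 Dg DXg gf.
  by move=> _; split=> // -[|//] _; exact: base gf.
move=> [Df Xf].
(* Y (X g) is a combination of f and g, so X g is in the domain of X^2. *)
have DYXg : D (Y (X g)).
  rewrite (_ : Y (X g) = s^-1%:C%C *: (f - g)).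
    by apply: (qn_domZ qX); exact: (qn_domB qX).
  by rewrite -gf addrAC subrr add0r scalerA -rmorphM mulVf ?gt_eqF// scale1r.
have DXXg := qn_comm_conv q_gt0 qX DXg DYXg.
have [_ XYXg] := qn_comm q_gt0 qX DXg DXXg.
have [|//|//||//|itXg Xle] := IHn (s * q) (X g) (X f).
- by rewrite mulr_gt0.
- rewrite -gf [g + _]addrC (qn_linP qX)// XYXg scalerA -rmorphM addrC.
  by [].
split=> // -[|k] kn; first exact: base gf.
by rewrite !iterSr; exact: Xle.
Qed.

(** The weight q is the one for which the relation 1 + q x^* x appears when
    the adjoint of the GNS operator is computed; see [closure_adjoint_rel]. *)
Definition resolvent (f : H) : H :=
  xget 0 [set g | [/\ D g, D (X g) & g + q%:C%C *: Y (X g) = f]].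

Lemma resolventP f : [/\ D (resolvent f), D (X (resolvent f)) &
  resolvent f + q%:C%C *: Y (X (resolvent f)) = f].
Proof.
have [g [Dg DXg] gf] := qn_resolvent q_gt0 qX f q_gt0.
apply: (xgetPex 0
  (P := [set g | [/\ D g, D (X g) & g + q%:C%C *: Y (X g) = f]])).
by exists g.
Qed.

Lemma dinf_resolvent f : dom_infty X f -> dom_infty X (resolvent f).
Proof.
move=> /dom_inftyP f1; apply/dom_inftyP => n; have [h1 h2 h3] := resolventP f.
exact: (resolvent_iter q_gt0 h1 h2 h3 (f1 n)).1.
Qed.

Lemma resolvent_le k f : dom_infty X f ->
  sqn ip (iter k X (resolvent f)) <= sqn ip (iter k X f).
Proof.
move=> /dom_inftyP f1; have [h1 h2 h3] := resolventP f.
exact: (resolvent_iter q_gt0 h1 h2 h3 (f1 k)).2.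
Qed.

Lemma adj_iter_sqn k f : dom_infty X f -> sqn ip (iter k X (Y f)) =
  (q ^+ k) ^+ 2 * q * sqn ip (iter k.+1 X f).
Proof.
move=> f1; have := iterX_iterY k 1 f1; rewrite muln1 /= => ->.
rewrite (sqnZ (inner_psd H)) /= (qn_sqn q_gt0 qX) -?iterS; first by ring.
by apply: dinf_dom; exact: dinf_iterX.
Qed.

End QNormalInf.

(** * Well-behaved representations *)
Section Easy.
Variables (R : realType) (q : R) (q_gt0 : 0 < q).
Local Notation C := R[i].
Local Notation A := (qplane q).

(** As the domain is dense, pi(x^* ) is the adjoint of X; words in x and x^*
    then act by products, and linearity does the rest. *)
Lemma well_behaved_act (H : hilbertType R) (X : partial_op H)
    (pi : star_rep H q) :
  q_normal q X -> rep_dom pi = dom_infty X ->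
  (forall f, rep_dom pi f -> pi (qx q) f = X f) ->
  forall a f, dom_infty X f -> pi a f = eval_op a X f.
Proof.
move=> qX domE piX; have psd := inner_psd H.
have piY f : dom_infty X f -> pi (qstar (qx q)) f = adjoint X f.
  move=> f1; apply: (dense_inj (rep_dom_dense pi)) => g g1.
  rewrite domE in g1; rewrite rep_star ?domE// qstarK piX ?domE//
    [RHS](psd_conj psd g).
  rewrite -(qn_adj qX) -?(psd_conj psd)//; exact: (dinf_dom (X := X)).
have piXn n f : dom_infty X f -> pi (qx q ^+ n) f = iter n X f.
  move=> f1; elim: n => [|n IHn]; first by rewrite expr0 rep_one// domE.
  rewrite exprS rep_mul ?domE// IHn piX// domE.
  exact: (dinf_iterX (X := X)).
have piYm m f : dom_infty X f ->
  pi (qstar (qx q) ^+ m) f = iter m (adjoint X) f.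
  move=> f1; elim: m => [|m IHm]; first by rewrite expr0 rep_one// domE.
  rewrite exprS rep_mul ?domE// IHm piY//.
  exact: (dinf_iterY q_gt0 qX).
move=> a f f1; move: a; apply: (@qlinear_eq R q H) => [c a b|c a b|m n].
- by apply: rep_linear; rewrite domE.
- exact: act_linl.
rewrite [RHS](act_mono q X) qmonoE rep_mul ?domE// piXn// piYm//.
exact: (dinf_iterX (X := X)).
Qed.

Lemma moment_strongly_positive (F : {scalar A}) :
  q_moment_functional F -> strongly_positive F.
Proof.
move=> [H [pi [[X [qX domE piX]] [xi xi1 Fxi]]]] a [_ a_ge0].
rewrite domE in xi1.
rewrite Fxi (well_behaved_act qX domE piX)//; exact: a_ge0.
Qed.

Section BuildRep.
Variables (H : hilbertType R) (X : partial_op H) (qX : q_normal q X).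
Hypothesis dX : dense (dom_infty X).

Lemma dinf_subspace : linear_subspace (dom_infty X).
Proof. by split; [exact: (dinf0 qX)|move=> c f g; exact: (dinfP qX)]. Qed.

Definition build_rep : star_rep H q := StarRep dinf_subspace dX
  (fun a f => @act_dinf R q q_gt0 H X qX a f)
  (fun a c f g => @act_lin R q q_gt0 H X qX a c f g)
  (fun c a b f _ => @act_linl R q H X c a b f)
  (fun f _ => @act1 R q H X f)
  (fun a b f => @actM R q q_gt0 H X qX a b f)
  (fun a f g => @act_star R q q_gt0 H X qX a f g).

Lemma build_rep_well_behaved : well_behaved build_rep.
Proof.
exists X; split=> // f _.
by rewrite /= /qx; exact: (act_mono q X 0 1).
Qed.
End BuildRep.
End Easy.

(** * Closures of densely defined operators *)
Section ClosureOp.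
Variables (R : realType) (H : hilbertType R) (V : lmodType R[i]).
Local Notation C := R[i].
Local Notation ip := (@inner R H : H -> H -> C).
Variables (Phi : V -> H).
Hypothesis Phi_lin : linear Phi.
Hypothesis Phi_total : forall f, (forall u, ip f (Phi u) = 0) -> f = 0.
Let psd := inner_psd H.

Section Closure.
Variable (T : V -> V).
Hypothesis T_lin : linear T.

(** A relation, because the closure need not be the graph of a function before
    a formal adjoint of T is known; see [graph_closure_uniq]. *)
Definition graph_closure (f h : H) : Prop := exists u : nat -> V,
  form_cvg ip (fun n => Phi (u n)) f /\ form_cvg ip (fun n => Phi (T (u n))) h.

Lemma graph_closure_Phi u : graph_closure (Phi u) (Phi (T u)).
Proof.
by exists (fun _ => u); split=> e e0; exists 0%N => n _;
  rewrite subrr /sqn (psd0l psd).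
Qed.

Lemma graph_closure_comb (c : C) f g h k : graph_closure f h ->
  graph_closure g k ->
  graph_closure (c *: f + g) (c *: h + k).
Proof.
move=> [u [uf uh]] [v [vg vk]]; exists (fun n => c *: u n + v n); split.
  under eq_fun do rewrite Phi_lin; exact: form_cvg_comb.
under eq_fun do rewrite T_lin Phi_lin; exact: form_cvg_comb.
Qed.

(** A diagonal sequence. *)
Lemma graph_closure_closed x y f h : (forall n, graph_closure (x n) (y n)) ->
  form_cvg ip x f -> form_cvg ip y h -> graph_closure f h.
Proof.
move=> xy xf yh.
have approx n : {u | sqn ip (Phi u - x n) < n.+1%:R^-1 /\
    sqn ip (Phi (T u) - y n) < n.+1%:R^-1}.
  apply: cid; have n0 : (0 : R) < n.+1%:R^-1 by rewrite invr_gt0.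
  have [u [ux uy]] := xy n.
  have [N1 N1P] := ux _ n0; have [N2 N2P] := uy _ n0.
  exists (u (maxn N1 N2)); split.
    by apply: N1P; exact: leq_maxl.
  by apply: N2P; exact: leq_maxr.
pose u n := sval (approx n); exists u.
have key (z w : nat -> H) l : form_cvg ip w l ->
    (forall n, sqn ip (z n - w n) < n.+1%:R^-1) -> form_cvg ip z l.
  move=> wl zw e e0; have e4 : 0 < e / 4 by lra.
  have [N1 N1P] := wl _ e4; have [N2 N2P] := inv_nat_small e4.
  exists (maxn N1 N2) => n; rewrite geq_max => /andP[/N1P h1 /N2P h2].
  rewrite -[z n](subrK (w n)) -addrA.
  have := parallelogram psd (z n - w n) (w n - l).
  have := sqn_ge0 psd (z n - w n - (w n - l)).
  by move: (zw n) h1 h2; move: (n.+1%:R^-1) => i; lra.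
split; [apply: key xf _|apply: key yh _] => n;
  by rewrite /u; case: (approx n) => v [].
Qed.
End Closure.

(** A total subspace is dense: the residue of the projection onto its closure
    is orthogonal to it. The closure is the part of [graph_closure] on the
    diagonal for T the identity. *)
Lemma Phi_approx f e : 0 < e -> exists u, sqn ip (Phi u - f) < e.
Proof.
move=> e0; have idL (c : C) (u v : V) : idfun (c *: u + v) =
  c *: idfun u + idfun v by [].
have [||x xK xC|g [u [ug _]] gP] :=
  psd_projection psd (K := [set f | graph_closure idfun f f]) _ _ _ f.
- have := graph_closure_Phi idfun 0; by rewrite (linear_fun0 Phi_lin).
- by move=> c g h; exact: graph_closure_comb.
- have [l xl] := hilbert_complete xC; exists l => //.
  exact: (graph_closure_closed xK xl xl).
have /eqP : f - g = 0 by apply: Phi_total => v; apply: gP;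
  exact: graph_closure_Phi.
rewrite subr_eq0 => /eqP ->; have [N NP] := ug _ e0.
by exists (u N); exact: NP.
Qed.

Section Pair.
Variables (T T' : V -> V).
Hypothesis adjTT' : forall u v,
  ip (Phi (T u)) (Phi v) = ip (Phi u) (Phi (T' v)).

Lemma graph_closure_adj f h v : graph_closure T f h ->
  ip h (Phi v) = ip f (Phi (T' v)).
Proof.
move=> [u [uf uh]]; apply: (form_cvg_eq psd uh uf) => n; exact: adjTT'.
Qed.

Lemma graph_closure_uniq f h h' : graph_closure T f h ->
  graph_closure T f h' -> h = h'.
Proof.
move=> fh fh'; apply/eqP; rewrite -subr_eq0; apply/eqP/Phi_total => v.
by rewrite (psdBl psd) (graph_closure_adj v fh) (graph_closure_adj v fh') subrr.
Qed.

Lemma graph_closure_adj2 f h g k : graph_closure T f h ->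
  graph_closure T' g k -> ip h g = ip f k.
Proof.
move=> fh [v [vg vk]]; rewrite (psd_conj psd g) (psd_conj psd k); congr (_^*).
apply: (form_cvg_eq psd vg vk) => n.
by rewrite (psd_conj psd h) (psd_conj psd f) (graph_closure_adj _ fh).
Qed.
End Pair.
End ClosureOp.

(** * A q-normal operator from formally adjoint letters *)
Section GNS.
Variables (R : realType) (q : R) (q_gt0 : 0 < q).
Variables (H : hilbertType R) (V : lmodType R[i]).
Local Notation C := R[i].
Local Notation ip := (@inner R H : H -> H -> C).
Variables (Phi : V -> H) (x xs r : V -> V).
Hypothesis Phi_lin : linear Phi.
Hypothesis Phi_total : forall f, (forall u, ip f (Phi u) = 0) -> f = 0.
Hypothesis x_lin : linear x.
Hypothesis xs_lin : linear xs.
Hypothesis x_adj : forall u v, ip (Phi (x u)) (Phi v) = ip (Phi u) (Phi (xs v)).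
Hypothesis xs_inner : forall u v,
  ip (Phi (xs u)) (Phi (xs v)) = q%:C%C * ip (Phi (x u)) (Phi (x v)).
Hypothesis r_inv : forall u v,
  ip (Phi (r u)) (Phi v) + q%:C%C * ip (Phi (x (r u))) (Phi (x v)) =
  ip (Phi u) (Phi v).
Let psd := inner_psd H.

Lemma xs_adj u v : ip (Phi (xs u)) (Phi v) = ip (Phi u) (Phi (x v)).
Proof. by rewrite (psd_conj psd (Phi v)) -x_adj -(psd_conj psd). Qed.

Lemma Phi_inj f g : (forall v, ip f (Phi v) = ip g (Phi v)) -> f = g.
Proof.
move=> fg; apply/eqP; rewrite -subr_eq0; apply/eqP/Phi_total => v.
by rewrite (psdBl psd) fg subrr.
Qed.

(** The commutation x x^* = q x^* x holds only after applying Phi, where it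
    follows from the equality of norms and totality. *)
Lemma Phi_x_xs u : Phi (x (xs u)) = q%:C%C *: Phi (xs (x u)).
Proof.
apply: Phi_inj => v.
by rewrite x_adj xs_inner (psdZl psd) xs_adj.
Qed.

Lemma graph_closure_x_xs f h : graph_closure Phi x f h ->
  exists2 k, graph_closure Phi xs f k & sqn ip k = q * sqn ip h.
Proof.
move=> fh; have [u [uf uh]] := fh.
have lin (T : V -> V) : linear T ->
    forall n m, Phi (T (u n)) - Phi (T (u m)) = Phi (T (u n - u m)).
  by move=> Tl n m; rewrite !(linear_funB Tl, linear_funB Phi_lin).
have sqE v : sqn ip (Phi (xs v)) = q * sqn ip (Phi (x v)).
  by rewrite /sqn xs_inner !Re_Im_simp /= mul0r subr0.
have [k uk] : exists k, form_cvg ip (fun n => Phi (xs (u n))) k.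
  apply: hilbert_complete => e e0.
  have [N NP] := form_cvg_cauchy psd uh (divr_gt0 e0 q_gt0).
  exists N => n m Nn Nm; have := NP n m Nn Nm.
  by rewrite !lin// sqE ltr_pdivlMr// mulrC.
exists k; first by exists u.
have qJ : (q%:C%C : C)^* = q%:C%C by exact: conjc_real.
have h1 v : ip k (Phi (xs v)) = ip h (q%:C%C *: Phi (x v)).
  by apply: (form_cvg_eq psd uk uh) => n; rewrite (psdZr psd) qJ xs_inner.
have h2 : ip k k = ip h (q%:C%C *: h).
  apply: (form_cvg_eq psd uk uh) => n.
  rewrite (psdZr psd) qJ (psd_conj psd k) h1 (psdZr psd) qJ rmorphM /=
    -(psd_conj psd).
  by congr (_ * _).
by rewrite /sqn h2 (psdZr psd) qJ !Re_Im_simp /= mul0r subr0.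
Qed.

Lemma graph_closure_xs_x f k : graph_closure Phi xs f k ->
  exists h, graph_closure Phi x f h.
Proof.
move=> [u [uf uk]].
have lin (T : V -> V) : linear T ->
    forall n m, Phi (T (u n)) - Phi (T (u m)) = Phi (T (u n - u m)).
  by move=> Tl n m; rewrite !(linear_funB Tl, linear_funB Phi_lin).
have sqE v : sqn ip (Phi (xs v)) = q * sqn ip (Phi (x v)).
  by rewrite /sqn xs_inner !Re_Im_simp /= mul0r subr0.
have [h uh] : exists h, form_cvg ip (fun n => Phi (x (u n))) h.
  apply: hilbert_complete => e e0.
  have [N NP] := form_cvg_cauchy psd uk (mulr_gt0 q_gt0 e0).
  exists N => n m Nn Nm; have := NP n m Nn Nm.
  by rewrite !lin// sqE ltr_pM2l.
by exists h, u.
Qed.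

Definition closure_op : partial_op H :=
  PartialOp [set f | exists h, graph_closure Phi x f h]
    (fun f => xget 0 (graph_closure Phi x f)).
Local Notation X := closure_op.

Lemma closure_opP f h : graph_closure Phi x f h -> X f = h.
Proof.
move=> fh; apply: (graph_closure_uniq Phi_total x_adj _ fh).
by apply: (xgetPex 0 (P := graph_closure Phi x f)); exists h.
Qed.

(** The adjoint of the closure of x is the closure of x^*. Otherwise some (a,
    b) other than 0 in the graph of the adjoint is orthogonal to the graph of
    x^*. As b is the value of the adjoint at a, this reads <a, Phi (v + x (x^*
    v))> = 0 for all v. Since x x^* = q x^* x, the vector a is orthogonal to
    the range of 1 + q x^* x, which contains every Phi v because r is a right
    inverse; hence a = 0, and then b = 0. *)
Lemma closure_adjoint_rel g h : adjoint_rel X g h <-> graph_closure Phi xs g h.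
Proof.
split=> [gh|gh f [k fk]]; last first.
  rewrite (closure_opP fk); exact: (graph_closure_adj2 x_adj fk gh).
have Phi0 : Phi 0 = 0 by exact: linear_fun0.
have xs0 : xs 0 = 0 by exact: linear_fun0.
have [||y f k yK yf yk|[g' h'] /= gh' gP] :=
  graph_projection ltr01
    (K := [set u : H * H | graph_closure Phi xs u.1 u.2]) _ _ _ g h.
- by have := graph_closure_Phi Phi xs 0; rewrite xs0 Phi0.
- by move=> c u v; exact: graph_closure_comb.
- exact: (graph_closure_closed yK yf yk).
(* (g - g', h - h') still lies in the graph of the adjoint of X. *)
have b_adj v : ip (h - h') (Phi v) = ip (g - g') (Phi (x v)).
  have dv : dom X (Phi v) by exists (Phi (x v)); exact: graph_closure_Phi.
  rewrite !(psdBl psd); congr (_ - _).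
    rewrite (psd_conj psd (Phi v)) -(gh _ dv) (closure_opP (graph_closure_Phi
      Phi x v)).
    by rewrite -(psd_conj psd).
  exact: (graph_closure_adj xs_adj v gh').
have a0 : g - g' = 0.
  apply: Phi_total => v;
    have := gP (Phi (r v), Phi (xs (r v))) (graph_closure_Phi _ _ _).
  rewrite /= mul1r b_adj -(psdDr psd) Phi_x_xs => <-; congr (ip _ _).
  apply: Phi_inj => w; rewrite (psdDl psd) (psdZl psd) xs_adj r_inv.
  by [].
have b0 : h - h' = 0.
  by apply: Phi_total => v; rewrite b_adj a0 (psd0l psd).
by move/eqP: a0 b0; rewrite subr_eq0 => /eqP -> /eqP;
  rewrite subr_eq0 => /eqP ->.
Qed.

Lemma closure_adjointP g h : graph_closure Phi xs g h -> adjoint X g = h.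
Proof.
move=> gh; apply: (graph_closure_uniq Phi_total xs_adj _ gh);
  apply/closure_adjoint_rel.
by apply: (xgetPex 0 (P := adjoint_rel X g)); exists h;
  apply/closure_adjoint_rel.
Qed.

Lemma closure_q_normal : q_normal q X.
Proof.
split.
- split; first split.
  + have Phi0 : Phi 0 = 0 by exact: linear_fun0.
    by exists (Phi (x 0)); rewrite -{1}Phi0; exact: graph_closure_Phi.
  + move=> c f g [h fh] [k gk]; exists (c *: h + k); exact: graph_closure_comb.
  move=> c f g [h fh] [k gk]; rewrite (closure_opP fh) (closure_opP gk).
  by apply: closure_opP; exact: graph_closure_comb.
- apply: approx_dense => f e /(Phi_approx Phi_lin Phi_total f)[u ue].
  by exists (Phi u) => //; exists (Phi (x u)); exact: graph_closure_Phi.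
- apply/seteqP; split=> f /= [h].
    by move=> /graph_closure_x_xs[k fk _]; exists k; apply/closure_adjoint_rel.
  by move=> /closure_adjoint_rel/graph_closure_xs_x.
move=> f [h fh]; have [k fk kE] := graph_closure_x_xs fh.
rewrite (closure_opP fh) (closure_adjointP fk) !normE -rmorphM; congr (_%:C%C).
by rewrite /form_norm kE sqrtrM// ltW.
Qed.

Lemma closure_opPhi u : X (Phi u) = Phi (x u).
Proof. exact/closure_opP/graph_closure_Phi. Qed.

Lemma closure_adjPhi u : adjoint X (Phi u) = Phi (xs u).
Proof. exact/closure_adjointP/graph_closure_Phi. Qed.

Lemma closure_dinf u : dom_infty X (Phi u).
Proof.
apply/dom_inftyP => n; elim: n u => //= n IHn u; split.
  by exists (Phi (x u)); exact: graph_closure_Phi.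
by have := IHn (x u); rewrite -closure_opPhi.
Qed.

(** The vector representing F is the class of [one], which for words is the
    empty word. *)
Lemma gns_moment (F : {scalar (qplane q)}) (one : V) :
  (forall m n, F (qmono q m n) =
     ip (Phi (iter m xs (iter n x one))) (Phi one)) ->
  q_moment_functional F.
Proof.
move=> FE.
have dX : dense (dom_infty X).
  apply: approx_dense => f e /(Phi_approx Phi_lin Phi_total f)[u ue].
  by exists (Phi u) => //; exact: closure_dinf.
exists H, (build_rep q_gt0 closure_q_normal dX).
split; first exact: build_rep_well_behaved.
exists (Phi one); first exact: closure_dinf.
move=> a; change (F a = ip (act X a (Phi one)) (Phi one)).
move: a; apply: (@qlinear_eq R q C^o) => [c a b|c a b|m n].
- by rewrite linearP.
- by rewrite act_linl (psd_lin psd).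
rewrite FE act_mono /mono_op; congr (ip _ _).
have -> : iter n X (Phi one) = Phi (iter n x one).
  by elim: n => [//|n IHn]; rewrite iterS IHn closure_opPhi.
by elim: m => [//|m IHm]; rewrite [RHS]iterS -IHm closure_adjPhi.
Qed.

End GNS.

(** * Linear maps on polynomials *)
Section PolyLin.
Variables (R : realType).
Local Notation C := R[i].
Local Notation P := {poly C}.

Lemma poly_linear_eq (U : lmodType C) (f g : P -> U) : linear f -> linear g ->
  (forall n, f 'X^n = g 'X^n) -> f =1 g.
Proof.
move=> fl gl fg u.
pose F : {linear P -> U} := HB.pack f (GRing.isLinear.Build _ _ _ _ f fl).
pose G : {linear P -> U} := HB.pack g (GRing.isLinear.Build _ _ _ _ g gl).
rewrite -[u]coefK poly_def; change (F (\sum_(i < size u) u`_i *: 'X^i) =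
  G (\sum_(i < size u) u`_i *: 'X^i)).
rewrite !linear_sum; apply: eq_bigr => i _.
by rewrite !linearZZ; congr (_ *: _); exact: fg.
Qed.

Definition lin_ext (U : lmodType C) (E : nat -> U) (u : P) : U :=
  \sum_(i < size u) u`_i *: E i.

Lemma lin_extE (U : lmodType C) (E : nat -> U) (u : P) N : (size u <= N)%N ->
  lin_ext E u = \sum_(i < N) u`_i *: E i.
Proof.
move=> uN; apply: (@sum_trunc U (fun i => u`_i *: E i)) => i ui.
  by rewrite nth_default// scale0r.
by rewrite nth_default ?scale0r// (leq_trans uN).
Qed.

Lemma lin_ext_linear (U : lmodType C) (E : nat -> U) : linear (lin_ext E).
Proof.
move=> c u v; pose N := maxn (size (c *: u + v)) (maxn (size u) (size v)).
rewrite !(@lin_extE _ _ _ N) ?leq_max ?leqnn ?orbT//.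
rewrite scaler_sumr -big_split; apply: eq_bigr => i _ /=.
by rewrite coefD coefZ scalerDl scalerA.
Qed.

HB.instance Definition _ (U : lmodType C) (E : nat -> U) :=
  GRing.isLinear.Build C P U *:%R (lin_ext E) (lin_ext_linear E).

Lemma lin_extXn (U : lmodType C) (E : nat -> U) n : lin_ext E 'X^n = E n.
Proof.
rewrite /lin_ext size_polyXn big_ord_recr /= big1 ?add0r => [|i _].
  by rewrite coefXn eqxx scale1r.
by rewrite coefXn (ltn_eqF (ltn_ord i)) scale0r.
Qed.

End PolyLin.

(** * Linear functionals below a sublinear one *)
Section HahnBanach.
Variables (R : realType).
Local Notation C := R[i].
Local Notation P := {poly C}.

Record sublinear (p : P -> R) : Prop := Sublinear {
  sublinD : forall u v, p (u + v) <= p u + p v ;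
  sublinZ : forall t u, 0 <= t -> p (t%:C%C *: u) <= t * p u }.

Lemma sublin0 p : sublinear p -> p 0 = 0.
Proof.
move=> ps; apply/eqP; rewrite eq_le; apply/andP; split.
  by have := sublinZ ps 0 (lexx 0); rewrite scale0r mul0r.
by have := sublinD ps 0 0; rewrite addr0; lra.
Qed.

Lemma sublinN p u : sublinear p -> - p (- u) <= p u.
Proof. by move=> ps; have := sublinD ps u (- u); rewrite subrr sublin0//;
  lra. Qed.

Definition straighten_set (e : P) (p : P -> R) (u : P) : set R :=
  [set p (u + t%:C%C *: e) - t * p e | t in [set t | 0 <= t]].

(** The largest sublinear functional below p with value - p e at - e: writing
    u as (u + t e) - t e bounds its value at u by p (u + t e) - t (p e) for
    all t >= 0. *)
Definition straighten (e : P) (p : P -> R) (u : P) : R :=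
  inf (straighten_set e p u).

Variable (e : P).

Lemma straighten_has_inf p u : sublinear p -> has_inf (straighten_set e p u).
Proof.
move=> ps; split; first by exists (p (u + 0%:C%C *: e) - 0 * p e), 0 => //=.
exists (- p (- u)) => _ [t /= t0 <-].
have := sublinD ps (u + t%:C%C *: e) (- u).
rewrite addrAC subrr add0r => h.
have [->|t1] := eqVneq t 0.
  by rewrite scale0r addr0 mul0r subr0; exact: sublinN.
have := sublinZ ps (t%:C%C *: e) (t := t^-1); rewrite invr_ge0 => /(_ t0).
rewrite scalerA -rmorphM mulVf// scale1r ler_pdivlMl ?lt_def ?t1//; lra.
Qed.

Lemma straighten_le p u t : sublinear p -> 0 <= t ->
  straighten e p u <= p (u + t%:C%C *: e) - t * p e.
Proof.
by move=> ps t0; apply: ge_inf; [exact: (straighten_has_inf u ps).2|exists t].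
Qed.

Lemma straighten_le_id p u : sublinear p -> straighten e p u <= p u.
Proof. by move=> ps; have := straighten_le u ps (lexx 0);
  rewrite scale0r addr0 mul0r subr0. Qed.

Lemma straighten_ge p u M : sublinear p ->
  (forall t, 0 <= t -> M <= p (u + t%:C%C *: e) - t * p e) ->
    M <= straighten e p u.
Proof.
move=> ps Mle; apply: lb_le_inf; first exact: (straighten_has_inf u ps).1.
by move=> _ [t /= t0 <-]; exact: Mle.
Qed.

Lemma straighten_sublinear p : sublinear p -> sublinear (straighten e p).
Proof.
move=> ps; split=> [u v|c u].
  rewrite -lerBlDl; apply: (straighten_ge ps) => t t0.
  rewrite lerBlDl -lerBlDr; apply: (straighten_ge ps) => s s0.
  rewrite lerBlDr; apply: le_trans (straighten_le _ ps (addr_ge0 s0 t0)) _.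
  rewrite rmorphD scalerDl addrACA.
  by have := sublinD ps (u + s%:C%C *: e) (v + t%:C%C *: e); lra.
rewrite le_eqVlt => /orP[/eqP <-|c0].
  by rewrite scale0r mul0r -(sublin0 ps); exact: straighten_le_id.
rewrite mulrC -ler_pdivrMr//; apply: (straighten_ge ps) => t t0.
rewrite ler_pdivrMr//;
  apply: le_trans (straighten_le _ ps (mulr_ge0 (ltW c0) t0)) _.
rewrite rmorphM -scalerA -scalerDr.
by have := sublinZ ps (u + t%:C%C *: e) (ltW c0); lra.
Qed.

Lemma straighten_flat p : sublinear p ->
  straighten e p (- e) <= - straighten e p e.
Proof.
move=> ps; have := straighten_le (- e) ps ler01.
rewrite scale1r addNr (sublin0 ps) mul1r sub0r => h.
by apply: le_trans h _; rewrite lerN2; exact: straighten_le_id.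
Qed.
End HahnBanach.

Section HahnBanach2.
Variables (R : realType) (p : {poly R[i]} -> R) (ps : sublinear p).
Local Notation C := R[i].
Local Notation P := {poly C}.

(** Each monomial carries two real directions, spanned by 'X^n and i 'X^n. *)
Fixpoint straightened (n : nat) : P -> R :=
  if n is n'.+1
  then straighten ('i%C *: 'X^n') (straighten 'X^n' (straightened n'))
  else p.

Lemma straightened_sublinear n : sublinear (straightened n).
Proof. by elim: n => //= n IHn; do 2!apply: straighten_sublinear. Qed.

Lemma straightened_anti m n u : (m <= n)%N ->
  straightened n u <= straightened m u.
Proof.
elim: n => [|n IHn]; first by case: m.
rewrite leq_eqVlt => /orP[/eqP -> //|/IHn]; apply: le_trans => /=.
apply: le_trans (straighten_le_id _ _ (straightened_sublinear n)).
by apply: straighten_le_id; apply: straighten_sublinear;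
  exact: straightened_sublinear.
Qed.

(** A functional that is flat along e bounds every sublinear functional below
    it by a linear one on the real line through e. *)
Lemma flat_real_line (p1 p2 : P -> R) e t : sublinear p1 -> sublinear p2 ->
  (forall u, p2 u <= p1 u) -> p1 (- e) <= - p1 e ->
    p2 (t%:C%C *: e) <= t * p1 e.
Proof.
move=> s1 s2 p21 fl; have [t0|t0] := leP 0 t.
  apply: le_trans (sublinZ s2 e t0) _; exact: ler_wpM2l.
have nt0 : 0 <= - t by lra.
have := sublinZ s2 (- e) nt0; rewrite rmorphN scalerN scaleNr opprK => h.
apply: le_trans h _; have := p21 (- e); nra.
Qed.

(** The complex number with Re (c l) = Re c a + Im c b, where a and b are the
    values along the two real directions. *)
Definition hb_coef n : C :=
  Complex (straightened n.+1 'X^n) (- straightened n.+1 ('i%C *: 'X^n)).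

(** Straightening p along one real basis vector after the other fixes the
    value of L on all monomials, and every polynomial involves finitely many
    of them, so that a countable iteration replaces a maximality argument. *)
Lemma hahn_banach : exists L : {scalar P}, forall u, Re (L u) <= p u.
Proof.
exists (lin_ext (hb_coef : nat -> C^o)) => u.
apply: le_trans (_ : straightened (size u) u <= _);
  last exact: straightened_anti (leq0n _).
apply: le_trans (sublinN _ (straightened_sublinear _)); rewrite lerNr.
set m := size u.
suff key k : (k <= m)%N -> straightened m (\sum_(i < k) - (u`_i *: 'X^i)) <=
    \sum_(i < k) - Re (u`_i *: (hb_coef i : C^o)).
  have -> : - u = \sum_(i < m) - (u`_i *: 'X^i).
    by rewrite sumrN -poly_def coefK.
  by rewrite /lin_ext Re_sum -sumrN; exact: key.
elim: k => [|k IHk] km.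
  by rewrite !big_ord0 (sublin0 (straightened_sublinear _)).
rewrite !big_ord_recr /=;
  apply: le_trans (sublinD (straightened_sublinear _) _ _) _.
apply: lerD; first exact: IHk (ltnW km).
set c := u`_k.
have -> : - (c *: 'X^k) =
  (- Re c)%:C%C *: 'X^k + (- Im c)%:C%C *: ('i%C *: 'X^k) :> P.
  rewrite scalerA -scalerDl -scaleNr; congr (_ *: _).
  by apply: complex_ext; rewrite !Re_Im_simp /=; ring.
apply: le_trans (sublinD (straightened_sublinear _) _ _) _.
have s0 := straightened_sublinear k; have s1 := straighten_sublinear 'X^k s0.
have s2 := straighten_sublinear ('i%C *: 'X^k) s1.
have le2 v : straightened m v <=
  straightened k.+1 v by exact: straightened_anti.
have h1 : straightened k.+1 (- 'X^k) <= - straightened k.+1 'X^k.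
  apply: le_trans (straighten_le_id _ _ s1) _.
  apply: le_trans (straighten_flat _ s0) _.
  by rewrite lerN2; exact: (straighten_le_id _ _ s1).
have h2 := straighten_flat ('i%C *: 'X^k) s1.
have := flat_real_line (- Re c) s2 (straightened_sublinear m) le2 h1.
have := flat_real_line (- Im c) s2 (straightened_sublinear m) le2 h2.
rewrite /GRing.scale /= !Re_Im_simp /=; lra.
Qed.

End HahnBanach2.

(** * Positivity of a strongly positive functional *)
Section FPos.
Variables (R : realType) (q : R) (q_gt0 : 0 < q).
Local Notation C := R[i].
Local Notation A := (qplane q).
Variables (F : {scalar A}) (Fpos : strongly_positive F).

Definition expect (H : hilbertType R) (X : partial_op H) (a : A) (phi : H) :=
  inner (act X a phi) phi.

Lemma expect_lin H (X : partial_op H) (c : C) a b phi :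
  expect X (c *: a + b) phi = c * expect X a phi + expect X b phi.
Proof. by rewrite /expect act_linl (psd_lin (inner_psd H)). Qed.

Lemma expect_star H (X : partial_op H) (qX : q_normal q X) a phi :
  dom_infty X phi -> expect X (qstar a) phi = (expect X a phi)^*.
Proof.
move=> phi1; rewrite /expect -(psd_conj (inner_psd H)).
by rewrite (act_star q_gt0 qX (qstar a))// qstarK.
Qed.

Lemma functional_square_ge0 b : 0 <= F (qstar b * b).
Proof.
apply: Fpos; split; first by rewrite qstarM qstarK.
move=> H X qX phi phi1; rewrite -/(act X _ _) (actM q_gt0 qX)//.
rewrite (act_star q_gt0 qX _ (act_dinf q_gt0 qX b phi1) phi1) qstarK.
exact: (psd_ge0 (inner_psd H)).
Qed.

(** F (1 + h)^2 is real, and so are F 1 and F h^2. *)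
Lemma functional_hermitian_real h : qstar h = h -> Im (F h) = 0.
Proof.
move=> hh.
have s1 : qstar (1 : A) = 1 by exact: qstar_mono.
have su : qstar (1 + h) = 1 + h.
  by have := qstar_comb 1 1 h; rewrite rmorph1 !scale1r hh s1.
have := functional_square_ge0 (1 + h); have := functional_square_ge0 h;
  have := functional_square_ge0 1.
rewrite su hh s1 mulr1 mulrDl mul1r mulrDr mulr1 !raddfD /=.
move=> /ge0_Re_Im[_ i1] /ge0_Re_Im[_ ihh] /ge0_Re_Im[_];
  rewrite !Re_Im_simp i1 ihh; lra.
Qed.

(** The sum of a and its star is Hermitian and takes twice the real part of
    the value of a; i times their difference is Hermitian, hence has a real
    image. *)
Lemma functional_Re_ge0 a :
  (forall (H : hilbertType R) (X : partial_op H) phi, q_normal q X ->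
     dom_infty X phi -> 0 <= Re (expect X a phi)) -> 0 <= Re (F a).
Proof.
move=> a_ge0.
have starD (u v : A) : qstar (u + v) = qstar u + qstar v.
  by have := qstar_comb 1 u v; rewrite rmorph1 !scale1r.
have starZ c (u : A) : qstar (c *: u) = c^* *: qstar u.
  have := qstar_comb c u 0; rewrite !addr0 => ->.
  suff -> : qstar (0 : A) = 0 by rewrite addr0.
  by have := starD 0 0; rewrite addr0 => e; apply: (@addrI _ (qstar (0 : A)));
    rewrite addr0 -e.
have h1 : 0 <= F (a + qstar a).
  apply: Fpos; split; first by rewrite starD qstarK addrC.
  move=> H X qX phi phi1; change (0 <= expect X (a + qstar a) phi).
  have := expect_lin X 1 a (qstar a) phi; rewrite scale1r mul1r => ->.
  rewrite (expect_star qX)//; apply: ge0_of_Re_Im; rewrite !Re_Im_simp;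
    last by rewrite subrr.
  by rewrite addr_ge0// a_ge0.
have h2 : Im (F ('i%C *: (a - qstar a))) = 0.
  have starN (u : A) : qstar (- u) = - qstar u.
    by rewrite -scaleN1r starZ rmorphN rmorph1 scaleN1r.
  apply: functional_hermitian_real; rewrite starZ starD starN qstarK.
  have -> : ('i%C : C)^* = - 'i%C by apply: complex_ext;
    rewrite !Re_Im_simp //= oppr0.
  by rewrite scaleNr -scalerN opprB.
move: h1 h2; rewrite raddfD /= => /ge0_Re_Im[+ _].
rewrite linearZ /= raddfB /= !Re_Im_simp /=; lra.
Qed.
End FPos.

(** * Words in x, its adjoint and the resolvent *)
Section Words.
Variables (R : realType) (q : R).
Local Notation C := R[i].
Local Notation P := {poly C}.

(** [Some true] is the letter x, [Some false] is x^* and [None] is the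
    resolvent. Formal words stand for the vector fields (H, X, phi) |-> w phi:
    those range over all Hilbert spaces, and so form no type of the size of
    the Hilbert spaces themselves, whereas the GNS space must be one of
    these. *)
Definition word := seq (option bool).
Definition letter_x : option bool := Some true.
Definition letter_xs : option bool := Some false.
Definition letter_r : option bool := None.

(** Words are numbered, so that their formal combinations are polynomials,
    with the word of number n as 'X^n. Numbers that code no word denote the
    empty word. *)
Definition word_of (n : nat) : word := odflt [::] (unpickle n).
Definition code (w : word) : nat := pickle w.
Lemma codeK w : word_of (code w) = w.
Proof. by rewrite /word_of /code pickleK. Qed.

Definition shift l : P -> P := lin_ext (fun n => 'X^(code (l :: word_of n))).

Definition pair_of (k : nat) : nat * nat := odflt (0%N, 0%N) (unpickle k).

Lemma pair_ofK ij : pair_of (pickle ij) = ij.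
Proof. by rewrite /pair_of pickleK. Qed.

Definition conjp (v : P) : P := map_poly (Num.conj : C -> C) v.

(** The formal counterpart of the inner product of two combinations of words;
    see [pair_value_gram]. *)
Definition gram (u v : P) : P :=
  lin_ext (fun a => lin_ext (fun b => 'X^(pickle (a, b))) (conjp v)) u.

Section Eval.
Variables (H : hilbertType R) (X : partial_op H) (phi : H).
Local Notation ip := (@inner R H : H -> H -> C).

Definition letter_op (l : option bool) (f : H) : H :=
  match l with
  | Some true => X f
  | Some false => adjoint X f
  | None => resolvent q X f
  end.

Definition word_vec (n : nat) : H := foldr letter_op phi (word_of n).
Definition comb_vec (u : P) : H := lin_ext word_vec u.
Definition pair_value (m : P) : C :=
  lin_ext ((fun k => ip (word_vec (pair_of k).1) (word_vec (pair_of k).2)) :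
    nat -> C^o) m.

Lemma pair_value_linear : linear (pair_value : P -> C^o).
Proof. exact: lin_ext_linear. Qed.

Lemma pair_value_gram u v : pair_value (gram u v) =
  ip (comb_vec u) (comb_vec v).
Proof.
have psd := inner_psd H.
move: u; apply: (@poly_linear_eq R C^o) => [c u u'|c u u'|a].
- by rewrite /gram lin_ext_linear pair_value_linear.
- by rewrite /comb_vec lin_ext_linear (psd_lin psd).
rewrite /gram lin_extXn /comb_vec lin_extXn.
have key w : pair_value (lin_ext (fun b => 'X^(pickle (a, b))) w) =
    ip (word_vec a) (lin_ext word_vec (conjp w)).
  move: w; apply: (@poly_linear_eq R C^o) => [c u u'|c u u'|b].
  - by rewrite lin_ext_linear pair_value_linear.
  - rewrite /conjp rmorphD /= map_polyZ lin_ext_linear (psdDr psd) (psdZr psd).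
    by rewrite conjCK.
  by rewrite lin_extXn /pair_value lin_extXn pair_ofK /= /conjp map_polyXn
    lin_extXn.
rewrite key; congr (ip _ (lin_ext _ _)).
by apply/polyP => i; rewrite !coef_map /= conjCK.
Qed.

Hypotheses (q_gt0 : 0 < q) (qX : q_normal q X) (phi1 : dom_infty X phi).

Lemma letter_dinf l f : dom_infty X f -> dom_infty X (letter_op l f).
Proof.
case: l => [[]|]; [exact: dinfX|exact: (dinfY q_gt0 qX)|].
exact: (dinf_resolvent q_gt0 qX).
Qed.

Lemma word_vec_dinf n : dom_infty X (word_vec n).
Proof. by rewrite /word_vec; elim: (word_of n) => //= l w;
  exact: letter_dinf. Qed.

Lemma comb_vec_dinf u : dom_infty X (comb_vec u).
Proof.
rewrite /comb_vec /lin_ext; elim/big_ind: _ => [|f g|i _].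
- exact: (dinf0 qX).
- exact: (dinfD qX).
by apply: (dinfZ qX); exact: word_vec_dinf.
Qed.

Lemma word_vec_code w : word_vec (code w) = foldr letter_op phi w.
Proof. by rewrite /word_vec codeK. Qed.

Lemma comb_vec_shiftX u : comb_vec (shift letter_x u) = X (comb_vec u).
Proof.
move: u; apply: (@poly_linear_eq R H) => [c u v|c u v|n].
- by rewrite /comb_vec /shift !lin_ext_linear.
- rewrite /comb_vec lin_ext_linear (qn_linP qX)//; apply: dinf_dom;
  exact: comb_vec_dinf.
by rewrite /shift lin_extXn /comb_vec !lin_extXn word_vec_code.
Qed.

Lemma comb_vec_shiftY u : comb_vec (shift letter_xs u) = adjoint X (comb_vec u).
Proof.
move: u; apply: (@poly_linear_eq R H) => [c u v|c u v|n].
- by rewrite /comb_vec /shift !lin_ext_linear.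
- rewrite /comb_vec lin_ext_linear (qn_adjP qX)//; apply: dinf_dom;
  exact: comb_vec_dinf.
by rewrite /shift lin_extXn /comb_vec !lin_extXn word_vec_code.
Qed.

Lemma comb_vec_shiftR u : comb_vec (shift letter_r u) +
  q%:C%C *: adjoint X (X (comb_vec (shift letter_r u))) = comb_vec u.
Proof.
rewrite -comb_vec_shiftX -comb_vec_shiftY.
move: u; apply: (@poly_linear_eq R H) => [c u v|c u v|n].
- rewrite /comb_vec /shift !lin_ext_linear !scalerDr !scalerA [q%:C%C * c]mulrC.
  by rewrite addrACA.
- by rewrite /comb_vec lin_ext_linear.
rewrite comb_vec_shiftY comb_vec_shiftX /shift lin_extXn /comb_vec !lin_extXn
  word_vec_code /=.
by have [_ _] := resolventP q_gt0 qX (word_vec n).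
Qed.

Lemma comb_vec1 : comb_vec 'X^(code [::]) = phi.
Proof. by rewrite /comb_vec lin_extXn word_vec_code. Qed.

End Eval.

(** The constants are found before X and phi are given: x raises k by one, x^*
    raises it by one up to a power of q since X^k X^* = q^k X^* X^k, and the
    resolvent changes nothing. The induction therefore runs over all k. *)
Lemma word_vec_bound (q_gt0 : 0 < q) (w : word) k : exists (c : R) N, 0 <= c /\
  forall (H : hilbertType R) (X : partial_op H) phi, q_normal q X ->
    dom_infty X phi ->
    sqn (@inner R H : H -> H -> C) (iter k X (foldr (letter_op X) phi w)) <=
    c * sqn (@inner R H : H -> H -> C) (iter N X phi).
Proof.
elim: w k => [|l w IHw] k.
  by exists 1, k; split=> // H X phi _ _; rewrite mul1r.
have wd (H : hilbertType R) (X : partial_op H) phi (qX : q_normal q X) :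
    dom_infty X phi -> dom_infty X (foldr (letter_op X) phi w).
  move=> phi1; elim: (w) => //= l' w' IH; exact: (letter_dinf q_gt0 qX).
case: l => [[]|] /=.
- have [c [N [c0 cN]]] := IHw k.+1; exists c, N; split=> // H X phi qX phi1.
  by rewrite -iterSr; exact: cN.
- have [c [N [c0 cN]]] := IHw k.+1; exists ((q ^+ k) ^+ 2 * q * c), N; split.
    by apply: mulr_ge0 => //; apply: mulr_ge0; [exact: sqr_ge0|exact: ltW].
  move=> H X phi qX phi1; rewrite (adj_iter_sqn q_gt0 qX); last exact: wd.
  rewrite -[leRHS]mulrA.
  apply: ler_wpM2l; last exact: cN.
  by apply: mulr_ge0; [exact: sqr_ge0|exact: ltW].
have [c [N [c0 cN]]] := IHw k; exists c, N; split=> // H X phi qX phi1.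
apply: le_trans (cN _ _ _ qX phi1).
by apply: (resolvent_le q_gt0 qX); exact: wd.
Qed.

End Words.

(** * Extension of the functional to pairs of words *)
Section Extend.
Variables (R : realType) (q : R) (q_gt0 : 0 < q).
Local Notation C := R[i].
Local Notation A := (qplane q).
Local Notation P := {poly C}.
Variables (F : {scalar A}) (Fpos : strongly_positive F).

Lemma expectZ (H : hilbertType R) (X : partial_op H) (c : C) (a : A) phi :
  expect X (c *: a) phi = c * expect X a phi.
Proof. by rewrite /expect !actE linearZZ (psdZl (inner_psd H)). Qed.

Lemma expect0 (H : hilbertType R) (X : partial_op H) phi :
  expect X (0 : A) phi = 0.
Proof. by rewrite /expect actE linear0 (psd0l (inner_psd H)). Qed.

Lemma pair_valueZ (H : hilbertType R) (X : partial_op H) phi (c : C) m :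
  pair_value q X phi (c *: m) = c * pair_value q X phi m.
Proof. by rewrite /pair_value linearZZ. Qed.

(** Domination is required at all q-normal operators at once, the order for
    which the strongly positive F is monotone. *)
Definition dominates (a : A) (m : P) : Prop :=
  forall (H : hilbertType R) (X : partial_op H) phi, q_normal q X ->
    dom_infty X phi -> Re (pair_value q X phi m) <= Re (expect X a phi).

Lemma dominates_comb s t a b m n : 0 <= s -> 0 <= t -> dominates a m ->
  dominates b n ->
  dominates (s%:C%C *: a + t%:C%C *: b) (s%:C%C *: m + t%:C%C *: n).
Proof.
move=> s0 t0 am bn H X phi qX phi1.
rewrite pair_value_linear /= pair_valueZ expect_lin expectZ.
rewrite !Re_Im_simp /= !mul0r !subr0.
by apply: lerD; apply: ler_wpM2l => //; [exact: am|exact: bn].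
Qed.

(** By [word_vec_bound] and |<f, g>| <= |f|^2 + |g|^2 each pair of words is
    dominated by a combination of two monomials x^*N x^N. *)
Lemma dominated_ex m : exists a, dominates a m.
Proof.
rewrite -[m]coefK poly_def.
elim/big_ind: _ => [|u v [a au] [b bv]|i _].
- by exists 0 => H X phi _ _; rewrite /pair_value raddf0 expect0.
- exists (1%:C%C *: a + 1%:C%C *: b).
  by have := dominates_comb ler01 ler01 au bv; rewrite !scale1r.
set c := m`_i; have [c1 [N1 [c10 cN1]]] :=
  word_vec_bound q_gt0 (word_of (pair_of i).1) 0.
have [c2 [N2 [c20 cN2]]] := word_vec_bound q_gt0 (word_of (pair_of i).2) 0.
exists ((sqmod c * c1)%:C%C *: qmono q N1 N1 + c2%:C%C *: qmono q N2 N2).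
move=> H X phi qX phi1; have psd := inner_psd H.
have evE : pair_value q X phi (c *: 'X^i) =
    c * inner (word_vec q X phi (pair_of i).1) (word_vec q X phi (pair_of i).2).
  by rewrite pair_valueZ /pair_value lin_extXn.
have exN N : expect X (qmono q N N) phi = (sqn (@inner R H : H -> H ->
  C) (iter N X phi))%:C%C.
  rewrite /expect act_mono -(psd_sqn psd).
  have := mono_op_adj q_gt0 qX N 0 (dinf_iterX N phi1) phi1.
  by rewrite /mono_op /=.
rewrite expect_lin expectZ.
rewrite !exN evE -(psdZl psd) [in leRHS]cReD !cReM /= !mul0r !subr0.
have := cN1 _ _ _ qX phi1; have := cN2 _ _ _ qX phi1; rewrite /=.
set f := word_vec q X phi _; set g := word_vec q X phi _ => h2 h1.
have y := sqn_young psd 1 (c *: f) g.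
rewrite (sqnZ psd) -/(sqmod c) in y.
have h3 : sqmod c * sqn (@inner R H : H -> H ->
  C) f <= sqmod c * (c1 * sqn (@inner R H : H -> H -> C) (iter N1 X phi)).
  by rewrite ler_wpM2l ?sqmod_ge0.
have f0 := sqn_ge0 psd f; have g0 := sqn_ge0 psd g.
have : 0 <= sqmod c * sqn (@inner R H : H -> H ->
  C) f by rewrite mulr_ge0 ?sqmod_ge0.
rewrite -/f -/g in h1 h2.
move: y h1 h2 h3; rewrite -mulrA; lra.
Qed.



Lemma dominates0_ge0 a : dominates a 0 -> 0 <= Re (F a).
Proof.
move=> a0; apply: (functional_Re_ge0 q_gt0 Fpos) => H X phi qX phi1.
by have := a0 H X phi qX phi1; rewrite /pair_value raddf0.
Qed.

Lemma dominatesD a b m n : dominates a m -> dominates b n ->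
  dominates (a + b) (m + n).
Proof.
by move=> am bn; have := dominates_comb ler01 ler01 am bn; rewrite !scale1r.
Qed.

Lemma dominatesZ t a m : 0 <= t -> dominates a m ->
  dominates (t%:C%C *: a) (t%:C%C *: m).
Proof.
by move=> t0 am; have := dominates_comb t0 (lexx 0) am am;
  rewrite !scale0r !addr0.
Qed.

Definition upper (m : P) : R :=
  inf [set Re (F a) | a in [set a | dominates a m]].

(** If b dominates - m then a + b dominates 0, so Re F (a + b) is nonnegative
    and - Re F b is a lower bound. *)
Lemma upper_has_inf m : has_inf [set Re (F a) | a in [set a | dominates a m]].
Proof.
split; first by have [a am] := dominated_ex m; exists (Re (F a)), a.
have [b bm] := dominated_ex (- m).
exists (- Re (F b)) => _ [a am <-].
have := dominates0_ge0 (a := a + b); rewrite -(subrr m) raddfD /= cReD.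
by move=> /(_ (dominatesD am bm)); lra.
Qed.

Lemma upper_le a m : dominates a m -> upper m <= Re (F a).
Proof. by move=> am; apply: ge_inf; [exact: (upper_has_inf m).2|exists a]. Qed.

Lemma upper_ge m M : (forall a, dominates a m -> M <= Re (F a)) -> M <= upper m.
Proof.
move=> Mle; apply: lb_le_inf; first exact: (upper_has_inf m).1.
by move=> _ [a am <-]; exact: Mle.
Qed.

Lemma upper_sublinear : sublinear upper.
Proof.
split=> [u v|t u].
  rewrite -lerBlDl; apply: upper_ge => b bv.
  rewrite lerBlDl -lerBlDr; apply: upper_ge => a au.
  rewrite lerBlDr -cReD -raddfD; apply: upper_le; exact: dominatesD.
rewrite le_eqVlt => /orP[/eqP <-|t0].
  rewrite scale0r mul0r; have : dominates 0 0.
    by move=> H X phi _ _; rewrite /pair_value raddf0 expect0.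
  by move=> /upper_le; rewrite raddf0.
rewrite mulrC -ler_pdivrMr//; apply: upper_ge => a au.
rewrite ler_pdivrMr//; apply: le_trans (upper_le (dominatesZ (ltW t0) au)) _.
by rewrite linearZ /= !Re_Im_simp /= mul0r subr0 mulrC.
Qed.

Section Transfer.
Variables (L : {scalar P}) (LF : forall m, Re (L m) <= upper m).

Lemma transfer_le m a : dominates a m -> Re (L m) <= Re (F a).
Proof. by move=> /upper_le; apply: le_trans; exact: LF. Qed.

(** L extends F: both signs, and both the real and the imaginary direction, of
    the combination m are dominated by the corresponding multiples of a. *)
Lemma transfer_eq m a :
  (forall (H : hilbertType R) (X : partial_op H) phi, q_normal q X ->
     dom_infty X phi -> pair_value q X phi m = expect X a phi) -> L m = F a.
Proof.
move=> ma.
have key c : Re (c * L m) <= Re (c * F a).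
  have := @transfer_le (c *: m) (c *: a); rewrite !linearZ /=; apply.
  by move=> H X phi qX phi1; rewrite pair_valueZ expectZ ma.
have := key 1; have := key (-1); have := key 'i%C; have := key (- 'i%C).
rewrite !Re_Im_simp /= => h1 h2 h3 h4.
by apply: complex_ext; lra.
Qed.

Lemma transfer_eq2 m n :
  (forall (H : hilbertType R) (X : partial_op H) phi, q_normal q X ->
     dom_infty X phi -> pair_value q X phi m = pair_value q X phi n) ->
       L m = L n.
Proof.
move=> mn; have : L (m - n) = F 0.
  apply: transfer_eq => H X phi qX phi1.
  by rewrite expect0 /pair_value raddfB -/(pair_value _ _ _ _) /=
    -!/(pair_value _ _ _ _) mn// subrr.
by rewrite raddf0 raddfB => /eqP; rewrite subr_eq0 => /eqP.
Qed.

Lemma transfer_ge0 m :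
  (forall (H : hilbertType R) (X : partial_op H) phi, q_normal q X ->
     dom_infty X phi -> 0 <= pair_value q X phi m) -> 0 <= L m.
Proof.
move=> m0.
have key (c : C) : (forall z, 0 <= z -> Re (c * z) <= 0) -> Re (c * L m) <= 0.
  move=> cz; have := @transfer_le (c *: m) 0; rewrite raddf0 linearZ /=; apply.
  by move=> H X phi qX phi1; rewrite pair_valueZ expect0; apply: cz; exact: m0.
have k1 : Re (-1 * L m) <= 0.
  by apply: key => z /ge0_Re_Im[z0 _]; rewrite mulN1r cReN; lra.
have k2 : Re ('i%C * L m) <= 0.
  by apply: key => z /ge0_Re_Im[z0 iz]; rewrite cReM iz /=; lra.
have k3 : Re (- 'i%C * L m) <= 0.
  by apply: key => z /ge0_Re_Im[z0 iz]; rewrite cReM cReN cImN iz /=; lra.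
by apply: ge0_of_Re_Im; move: k1 k2 k3; rewrite !Re_Im_simp /=; lra.
Qed.

Lemma transfer_conj m n :
  (forall (H : hilbertType R) (X : partial_op H) phi, q_normal q X ->
     dom_infty X phi -> pair_value q X phi n = (pair_value q X phi m)^*) ->
       L n = (L m)^*.
Proof.
move=> mn.
have key c d : (forall z : C, Re (c * z^* + d * z) <= 0) ->
  Re (c * L n + d * L m) <= 0.
  move=> cz; have := @transfer_le (c *: n + d *: m) 0.
  rewrite raddf0 raddfD /= !linearZ /=; apply.
  by move=> H X phi qX phi1;
    rewrite pair_value_linear /= pair_valueZ expect0 mn//; exact: cz.
have k1 : Re (1 * L n + (-1) * L m) <= 0.
  by apply: key => z; rewrite !Re_Im_simp /=; lra.
have k2 : Re ((-1) * L n + 1 * L m) <= 0.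
  by apply: key => z; rewrite !Re_Im_simp /=; lra.
have k3 : Re ('i%C * L n + 'i%C * L m) <= 0.
  by apply: key => z; rewrite !Re_Im_simp /=; lra.
have k4 : Re (- 'i%C * L n + - 'i%C * L m) <= 0.
  by apply: key => z; rewrite !Re_Im_simp /=; lra.
by apply: complex_ext; move: k1 k2 k3 k4; rewrite !Re_Im_simp /=; lra.
Qed.

Definition gram_form (u v : P) : C := L (gram u v).

Lemma gram_form_psd : psd_form gram_form.
Proof.
split=> [c u v w|u v|u].
- by rewrite /gram_form /gram lin_ext_linear linearP.
- apply: transfer_conj => H X phi qX phi1.
  by rewrite !pair_value_gram -(psd_conj (inner_psd H)).
apply: transfer_ge0 => H X phi qX phi1; rewrite pair_value_gram.
exact: (psd_ge0 (inner_psd H)).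
Qed.

Lemma gram_form_lin_eq u v u' v' (c : C) u2 v2 :
  (forall (H : hilbertType R) (X : partial_op H) phi, q_normal q X ->
     dom_infty X phi -> inner (comb_vec q X phi u) (comb_vec q X phi v) +
      c * inner (comb_vec q X phi u2) (comb_vec q X phi v2) =
      inner (comb_vec q X phi u') (comb_vec q X phi v')) ->
  gram_form u v + c * gram_form u2 v2 = gram_form u' v'.
Proof.
move=> h; rewrite addrC /gram_form.
have -> : c * L (gram u2 v2) + L (gram u v) = L (c *: gram u2 v2 + gram u v).
  by rewrite linearP.
apply: transfer_eq2 => H X phi qX phi1.
by rewrite pair_value_linear /= !pair_value_gram addrC h.
Qed.

Lemma moment_of_extension : q_moment_functional F.
Proof.
pose B := gram_form; have psdB := gram_form_psd.
pose Phi := embed psdB.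
have PhiB u v : inner (Phi u) (Phi v) = B u v by exact: embed_inner.
apply: (@gns_moment R q q_gt0 _ _ Phi (@shift R letter_x) (@shift R letter_xs)
  (@shift R letter_r)
  (@embed_linear _ _ psdB) (@embed_total _ _ psdB) _ _ _ _ _ F 'X^(code [::])).
- exact: lin_ext_linear.
- exact: lin_ext_linear.
- move=> u v; rewrite !PhiB; apply: transfer_eq2 => H X phi qX phi1.
  rewrite !pair_value_gram comb_vec_shiftX// comb_vec_shiftY// (qn_adj qX)//;
  by apply: dinf_dom; exact: comb_vec_dinf.
- move=> u v; rewrite !PhiB.
  have := @gram_form_lin_eq 0 0 (shift letter_xs u) (shift letter_xs v) q%:C%C
    (shift letter_x u) (shift letter_x v).
  rewrite {1}/gram_form {1}/gram raddf0 raddf0 add0r => -> // H X phi qX phi1.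
  rewrite /comb_vec raddf0 (psd0l (inner_psd H)) add0r -!/(comb_vec _ _ _ _).
  rewrite !comb_vec_shiftX// !comb_vec_shiftY// (qn_inner q_gt0 qX)//;
  by apply: dinf_dom; exact: comb_vec_dinf.
- move=> u v; rewrite !PhiB; apply: gram_form_lin_eq => H X phi qX phi1.
  have psd := inner_psd H.
  rewrite -[in RHS](comb_vec_shiftR q_gt0 qX phi1 u) (psdDl psd) (psdZl psd).
  rewrite !comb_vec_shiftX//; congr (_ + _ * _).
  rewrite [RHS](psd_conj psd (comb_vec q X phi v)) -(qn_adj qX).
  + by rewrite -(psd_conj psd).
  + by apply: dinf_dom; exact: comb_vec_dinf.
  by apply: dinf_dom; apply: (dinfX (X := X)); exact: comb_vec_dinf.
move=> m n; rewrite PhiB; symmetry; apply: transfer_eq => H X phi qX phi1.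
rewrite pair_value_gram comb_vec1 /expect act_mono; congr (inner _ _).
have -> : forall v, comb_vec q X phi (iter m (shift letter_xs) v) =
    iter m (adjoint X) (comb_vec q X phi v).
  by move=> v; elim: m => [//|m IHm]; rewrite !iterS comb_vec_shiftY// IHm.
rewrite /mono_op; congr (iter m _ _).
elim: n => [|n IHn]; first by rewrite /= comb_vec1.
by rewrite !iterS comb_vec_shiftX// IHn.
Qed.

End Transfer.

Lemma strongly_positive_moment : q_moment_functional F.
Proof.
have [L LF] := hahn_banach upper_sublinear.
exact: (moment_of_extension LF).
Qed.

End Extend.

Theorem theorem3 (R : realType) (q : R) (q_gt0 : 0 < q)
    (F : {scalar (qplane q)}) :
  q_moment_functional F <-> strongly_positive F.
Proof.
split; first exact: moment_strongly_positive.
exact: strongly_positive_moment.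
Qed.
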